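(* Let $\Omega$ be an infinite set, let $G=\mathrm{Sym}(\Omega)$, and for $k\ge 2$ let $\langle C_k;\Gamma_k\rangle$ be the free finite cover of $\langle[\Omega]^k;G\rangle$ with fibre groups $\mathbb{Z}_4$ acting regularly, binding groups $\mathbb{Z}_2$, and canonical homomorphisms $\chi_w$ given by the sign of the restriction to $w$ (as defined in the context). Then: (i) The group $\Gamma_2$ has no proper full subgroup. (ii) For every $\ell\ge 2$ there exists a continuous homomorphism $\gamma_{2,\ell}:\Gamma_2\to\Gamma_\ell$ which extends the natural $G$-homomorphism $\alpha_{2,\ell}:\mathbb{Z}_2^{[\Omega]^2}\to\mathbb{Z}_2^{[\Omega]^\ell}$ between the kernels, and such that the $\Gamma_\ell$-conjugates of $\gamma_{2,\ell}(\Gamma_2)$ are precisely the minimally full subgroups of $\Gamma_\ell$.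
   Context: For a set $C$, $\mathrm{Sym}(C)$ is a topological group whose open sets are the arbitrary unions of cosets of pointwise stabilizers of finite subsets of $C$. A permutation structure $\langle C;\Gamma\rangle$ is a set $C$ with a closed subgroup $\Gamma\le\mathrm{Sym}(C)$. Let $\rho$ be a $\Gamma$-invariant equivalence relation on $C$ with all classes finite, $W=C/\rho$, $\mu:\Gamma\to\mathrm{Sym}(W)$ the induced map, and $G=\mu(\Gamma)$ (a closed subgroup of $\mathrm{Sym}(W)$); then $\langle C;\Gamma\rangle$ is called a finite cover of $\langle W;G\rangle$ with kernel $K=\ker\mu$. A subgroup $\Sigma\le\Gamma$ is full (with respect to $\mu$) if it is closed and $\mu(\Sigma)=G$; it is minimally full if it is full and has no proper full subgroup. For $w\in W$ let $C(w)$ be the $\rho$-class labelled by $w$. The fibre group $F(w)$ is the permutation group induced on $C(w)$ by the setwise stabilizer of $C(w)$ in $\Gamma$; the binding group $B(w)\trianglelefteq F(w)$ is the permutation group induced on $C(w)$ by $K$. The canonical homomorphism $\chi_w:G_w\to F(w)/B(w)$ is $\chi_w(g)=(h|_{C(w)})B(w)$, where $h\in\Gamma$ is any element with $\mu(h)=g$. When $G$ is transitive on $W$, given finite permutation groups $B\trianglelefteq F$ and a continuous epimomorphism $\chi:G_w\to F/B$, there is a unique finite cover of $\langle W;G\rangle$ with these data (fibre group $F$, binding group $B$, canonical homomorphism $\chi$) whose kernel is the full direct product $\prod_{w\in W}B$; it is called the free finite cover with these data. $[\Omega]^k$ is the set of $k$-element subsets of $\Omega$; $G=\mathrm{Sym}(\Omega)$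 acts on it as a closed permutation group. For $w\in[\Omega]^k$, $G_w=\mathrm{Sym}(w)\times\mathrm{Sym}(\Omega\setminus w)$ and $\chi_w:G_w\to\mathbb{Z}_2$ sends $g$ to the sign of $g|_w$ (with $\mathbb{Z}_4/\mathbb{Z}_2$ identified with $\mathbb{Z}_2$). The free finite cover $\langle C_k;\Gamma_k\rangle$ of $\langle[\Omega]^k;G\rangle$ with fibre groups $\mathbb{Z}_4$ acting regularly, binding group $\mathbb{Z}_2\le\mathbb{Z}_4$, and canonical homomorphisms $\chi_w$ gives an exact sequence $0\to\mathbb{Z}_2^{[\Omega]^k}\to\Gamma_k\to\mathrm{Sym}(\Omega)\to1$, where the kernel is identified with the group $\mathbb{Z}_2^{[\Omega]^k}$ of functions $[\Omega]^k\to\mathbb{Z}_2$ ($f$ acts on the fibre over $w$ as the element $f(w)$ of the binding group). Full and minimally full subgroups of $\Gamma_k$ are with respect to $\Gamma_k\to\mathrm{Sym}(\Omega)$. For $2\le\ell$, $\alpha_{2,\ell}:\mathbb{Z}_2^{[\Omega]^2}\to\mathbb{Z}_2^{[\Omega]^\ell}$ is given by $\alpha_{2,\ell}(f)(w)=\sum_{v\in[w]^2}f(v)$ for $w\in[\Omega]^\ell$, where $[w]^2$ is the set of 2-subsets of $w$. *)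

(* Defs.v *)
From HB Require Import structures.
From mathcomp Require Import all_boot all_order all_algebra all_fingroup finmap.
From mathcomp Require Import all_classical topology.

Set Implicit Arguments.
Unset Strict Implicit.
Unset Printing Implicit Defensive.

Import GRing.Theory.

Local Open Scope classical_set_scope.

(* SymGroup T for an arbitrary type T. As for MathComp's {perm T}, the product is
   "first f, then g": (f * g) x = g (f x). *)
Record SymGroup (T : Type) := MkSymGroup {
  sym_fun :> T -> T;
  sym_inv : T -> T;
  sym_funK : cancel sym_fun sym_inv;
  sym_invK : cancel sym_inv sym_fun }.

Lemma symP (T : Type) (f g : SymGroup T) : f =1 g <-> f = g.
Proof.
split=> [fg|->//]; case: f g fg => [f f' fK f'K] [g g' gK g'K] /= fg.
have E : f = g by apply/funext.
subst g; have E' : f' = g'.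
  by apply/funext => x; rewrite -[x in LHS]g'K fK.
by subst g'; congr MkSymGroup; apply: Prop_irrelevance.
Qed.

HB.instance Definition _ (T : Type) := gen_eqMixin (SymGroup T).
HB.instance Definition _ (T : Type) := gen_choiceMixin (SymGroup T).

Section SymGroupTheory.
Variable T : Type.
Implicit Types f g h : SymGroup T.

Definition sym_one : SymGroup T := @MkSymGroup T id id (fun=> erefl) (fun=> erefl).

Definition sym_mul f g : SymGroup T :=
  MkSymGroup (can_comp (sym_funK g) (sym_funK f))
        (can_comp (sym_invK f) (sym_invK g)).

Definition sym_invg f : SymGroup T := MkSymGroup (sym_invK f) (sym_funK f).

Let sym_mulA : associative sym_mul. Proof. by move=> f g h; apply/symP. Qed.
Let sym_mul1 : left_id sym_one sym_mul. Proof. by move=> f; apply/symP. Qed.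
Let sym_mulr1 : right_id sym_one sym_mul. Proof. by move=> f; apply/symP. Qed.
Let sym_mulV : left_inverse sym_one sym_invg sym_mul.
Proof. by move=> f; apply/symP => x /=; rewrite sym_invK. Qed.
Let sym_mulVr : right_inverse sym_one sym_invg sym_mul.
Proof. by move=> f; apply/symP => x /=; rewrite sym_funK. Qed.

HB.instance Definition _ := isGroup.Build (SymGroup T)
  sym_mulA sym_mul1 sym_mulr1 sym_mulV sym_mulVr.
HB.instance Definition _ := isPointed.Build (SymGroup T) sym_one.

Lemma sym1E x : (1%g : SymGroup T) x = x. Proof. by []. Qed.
Lemma symM f g x : (f * g)%g x = g (f x). Proof. by []. Qed.

Definition pstab (A : set T) : set (SymGroup T) :=
  [set s | forall a, A a -> s a = a].

Let coset_ (i : SymGroup T * set T) : set (SymGroup T) :=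
  [set (s * i.1)%g | s in pstab i.2].

Let coset_E f A g : coset_ (f, A) g <-> forall a, A a -> g a = f a.
Proof.
split=> [[s sA <-] a Aa|gf]; first by rewrite symM sA.
exists (g * f^-1)%g; last by rewrite -mulgA mulVg mulg1.
by move=> a Aa; rewrite symM gf // -symM mulgV.
Qed.

Let coset_cover : \bigcup_(i in [set i | finite_set i.2]) coset_ i = setT.
Proof.
by rewrite -subTset => g _; exists (g, set0); [exact: finite_set0|exact/coset_E].
Qed.

Let coset_join i j g : finite_set i.2 -> finite_set j.2 ->
  coset_ i g -> coset_ j g ->
  exists k, [/\ finite_set k.2, coset_ k g & coset_ k `<=` coset_ i `&` coset_ j].
Proof.
case: i j => [f A] [f' B] /= finA finB /coset_E gA /coset_E gB.
exists (g, A `|` B); split=> /=; first by rewrite finite_setU.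
  exact/coset_E.
move=> h /coset_E hg; split; apply/coset_E => a Aa.
  by rewrite hg ?gA//; left.
by rewrite hg ?gB//; right.
Qed.

(* open = union of cosets of pointwise stabilizers of finite sets *)
HB.instance Definition _ := isBaseTopological.Build (SymGroup T)
  coset_cover coset_join.

End SymGroupTheory.

Record is_subgroup (T : Type) (H : set (SymGroup T)) : Prop := {
  subgroup1 : H 1%g;
  subgroupM : forall f g, H f -> H g -> H (f * g)%g;
  subgroupV : forall f, H f -> H f^-1%g }.

Record is_perm_structure (C : Type) (Gamma : set (SymGroup C)) : Prop := {
  perm_structure_subgroup : is_subgroup Gamma;
  perm_structure_closed : closed Gamma }.

(* The quotient C / rho is presented by a surjection pi : C -> W, the relation
   rho being pi x = pi y; the fibre C(w) is the preimage of w. *)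
Section Covers.
Variables (C W : Type) (pi : C -> W).
Implicit Types (Gamma Sigma : set (SymGroup C)) (G : set (SymGroup W)).

Definition fibre (w : W) : set C := [set x | pi x = w].

(* mu h = g *)
Definition induces (h : SymGroup C) (g : SymGroup W) : Prop :=
  forall x, pi (h x) = g (pi x).

Definition mu_image Sigma : set (SymGroup W) :=
  [set g | exists2 h, Sigma h & induces h g].

Definition mu_ker Gamma : set (SymGroup C) := [set h | Gamma h /\ induces h 1%g].

Record is_finite_cover G Gamma : Prop := {
  cover_perm_structure : is_perm_structure Gamma;
  cover_surj : forall w, exists x, pi x = w;
  cover_finite : forall w, finite_set (fibre w);
  cover_invariant : forall h x y, Gamma h -> pi x = pi y -> pi (h x) = pi (h y);
  cover_image : mu_image Gamma = G }.

Definition fibre_stab Gamma (w : W) : set (SymGroup C) :=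
  [set h | Gamma h /\ h @` fibre w = fibre w].

(* The permutation group induced on the image of b by H, read on X along b. *)
Definition induced_group (X : finType) (b : X -> C) (H : set (SymGroup C)) :
    set {perm X} :=
  [set p : {perm X} | exists2 h, H h & forall x, h (b x) = b (p x)].

(* b : X -> C(w) identifies (F(w), B(w), chi_w) with (F, B, chi). The base
   group is given by an action act : H -> SymGroup W, and only the values of chi on
   the stabilizer of w matter. *)
Record cover_chart Gamma (H : Type) (act : H -> SymGroup W) (X : finType)
    (F B : {group {perm X}}) (chi : H -> coset_of B) (w : W) (b : X -> C) :
    Prop := {
  chart_bij : set_bij [set: X] (fibre w) b;
  chart_fibre_group : induced_group b (fibre_stab Gamma w) = [set` F];
  chart_binding_group : induced_group b (mu_ker Gamma) = [set` B];
  chart_canonical : forall (g : H) (h : SymGroup C) (p : {perm X}),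
    act g w = w -> Gamma h -> induces h (act g) ->
    (forall x, h (b x) = b (p x)) -> chi g = coset B p }.

(* The kernel is the full direct product of the binding groups B(w). *)
Definition full_product_kernel Gamma : Prop :=
  mu_ker Gamma = [set h | forall w, exists2 h', mu_ker Gamma h' &
                          forall x, fibre w x -> h x = h' x].

Record is_free_cover Gamma (H : Type) (act : H -> SymGroup W) (X : finType)
    (F B : {group {perm X}}) (chi : W -> H -> coset_of B) : Prop := {
  free_cover_finite : is_finite_cover (range act) Gamma;
  free_cover_chart :
    forall w, exists b, cover_chart Gamma act F (chi w) w b;
  free_cover_kernel : full_product_kernel Gamma }.

Record is_full G Gamma Sigma : Prop := {
  full_subgroup : is_subgroup Sigma;
  full_closed : closed Sigma;
  full_sub : Sigma `<=` Gamma;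
  full_image : mu_image Sigma = G }.

Definition is_minimally_full G Gamma Sigma : Prop :=
  is_full G Gamma Sigma /\
  forall Sigma', is_full G Gamma Sigma' -> Sigma' `<=` Sigma -> Sigma' = Sigma.

End Covers.

Definition image_conj (C : Type) (Sigma : set (SymGroup C)) (h : SymGroup C) :
    set (SymGroup C) :=
  [set (h^-1 * s * h)%g | s in Sigma].

Section KSubsets.
Variables (Omega : choiceType) (k : nat).
Local Open Scope fset_scope.

Definition kset := {A : {fset Omega} | #|` A| == k}.

Lemma card_imfset_sym (g : SymGroup Omega) (A : {fset Omega}) :
  #|` [fset g x | x in A]| = #|` A|.
Proof. by rewrite card_imfset //; apply: can_inj (sym_funK g). Qed.

Lemma kset_imP (g : SymGroup Omega) (w : kset) : #|` [fset g x | x in val w]| == k.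
Proof. by rewrite card_imfset_sym (valP w). Qed.

Definition kset_im (g : SymGroup Omega) (w : kset) : kset :=
  exist _ [fset g x | x in val w] (kset_imP g w).

Lemma kset_imK (g h : SymGroup Omega) : cancel g h -> cancel (kset_im g) (kset_im h).
Proof.
move=> gK w; apply/val_inj => /=; apply/fsetP => x.
apply/imfsetP/idP => /= [[_ /imfsetP[y /= yw ->] ->]|xw].
  by rewrite gK.
by exists (g x); rewrite ?gK//; apply/imfsetP; exists x.
Qed.

Definition kset_act (g : SymGroup Omega) : SymGroup kset :=
  MkSymGroup (@kset_imK g g^-1%g (sym_funK g)) (@kset_imK g^-1%g g (sym_invK g)).

(* The restriction of g to w, for g stabilizing w (otherwise unspecified). *)
Definition restr_sym (w : {fset Omega}) (g : SymGroup Omega) : {perm w} :=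
  insubd (1%g : {perm w}) [ffun x : w => insubd x (g (val x))].

Lemma restr_symE (w : {fset Omega}) (g : SymGroup Omega) :
  [fset g x | x in w] = w -> forall x : w, val (restr_sym w g x) = g (val x).
Proof.
move=> gw x.
have gwP (y : w) : val (insubd y (g (val y))) = g (val y).
  rewrite val_insubd ifT // -[X in _ \in X]gw.
  by apply/imfsetP; exists (val y) => //; apply: valP.
rewrite -pvalE /restr_sym.
set f := [ffun y : w => _].
have finj : injectiveb f.
  apply/injectiveP => y z; rewrite !ffunE => /(congr1 val); rewrite !gwP.
  by move/(can_inj (sym_funK g))/val_inj.
by rewrite [pval _](insubdK (1%g : {perm w}) finj) ffunE gwP.
Qed.

Definition sign_on (w : kset) (g : SymGroup Omega) : bool :=
  odd_perm (restr_sym (val w) g).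

End KSubsets.

Definition Z4_shift (a : 'Z_4) : {perm 'Z_4} := perm (addrI a).

Definition Z4_reg : {group {perm 'Z_4}} := <[Z4_shift 1%R]>%G.

Definition Z2_in_Z4 : {group {perm 'Z_4}} := <[Z4_shift 2%:R%R]>%G.

Section SignCovers.
Variables (Omega : choiceType) (k : nat).
Variables (C : Type) (pi : C -> kset Omega k).

(* The sign in Z_2 = Z_4 / Z_2: an odd permutation goes to the generator. *)
Definition sign_chi (w : kset Omega k) (g : SymGroup Omega) : coset_of Z2_in_Z4 :=
  (coset Z2_in_Z4 (Z4_shift 1%R) ^+ sign_on w g)%g.

Definition symG : set (SymGroup (kset Omega k)) := range (@kset_act Omega k).

Definition is_sign_cover (Gamma : set (SymGroup C)) : Prop :=
  is_free_cover pi Gamma (@kset_act Omega k) Z4_reg sign_chi.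

(* The kernel element h is the function f : [Omega]^k -> Z_2, i.e. h acts on
   each fibre as the element f w of the binding group. The binding group is
   central in Z_4 and has one generator, so the chart b is immaterial. *)
Definition kernel_elt (Gamma : set (SymGroup C)) (f : kset Omega k -> 'Z_2)
    (h : SymGroup C) : Prop :=
  mu_ker pi Gamma h /\
  forall w (b : 'Z_4 -> C),
    cover_chart pi Gamma (@kset_act Omega k) Z4_reg (sign_chi w) w b ->
    forall x, h (b x) = b ((Z4_shift 2%:R%R ^+ f w)%g x).

End SignCovers.

Definition alpha (Omega : choiceType) (j l : nat) (f : kset Omega j -> 'Z_2)
    (w : kset Omega l) : 'Z_2 :=
  (\sum_(v \in [set v : kset Omega j | (val v `<=` val w)%fset]) f v)%R.

(* Main.v *)
Require Import Defs.
From HB Require Import structures.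
From mathcomp Require Import all_boot all_order all_algebra all_fingroup finmap.
From mathcomp Require Import all_classical topology.

(** Coordinates.  The fibres of a sign cover can be identified with Z_4 so that an
    element over g in Sym(Omega) maps the fibre over w to the fibre over g w by the
    translation by phi w, for a function phi from k-subsets to Z_4.  Modulo 2 this
    phi is a cocycle psi g of Sym(Omega), whose restriction to the stabilizer of w is
    the sign on w, and Gamma consists of all pairs (g, phi) with phi = psi g modulo 2
    (coords_exist).  Since the action on k-subsets is transitive, the class of psi is
    determined by these restrictions (cohomologous).  Summing the cocycle of
    Gamma_2 over the pairs in an l-subset also gives the sign (sign_sum), so the
    charts of Gamma_l may be normalized to make its cocycle equal to that sum; then
    gamma maps (g, phi) to (g, sum of phi over pairs).

    Kernels of full subgroups.  Let Sigma be full in Gamma_l and let M be its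
    kernel, a closed module of Z_2-valued functions on l-subsets.  By duality M is
    determined by the finite formal sums n of l-subsets that it annihilates
    (bipolar).  Squares of elements of Sigma over transpositions are members of M,
    and evaluating them on n shows that every pair of points lies in an even number
    of members of n (kernel_module_even).  Dually, M contains the image of alpha
    (alpha_kernel_module).  For l = 2 this is the first claim, and for all l it shows
    that conjugates of the range of gamma have no proper full subgroups.

    Full subgroups contain a conjugate of the range of gamma.  Modulo M, both
    Sigma and the range of gamma are sections of Gamma_l over Sym(Omega); they differ by
    a 1-cocycle f, and they are conjugate by an element of the kernel if f is a
    coboundary modulo M (cocycle_trivial).  Evaluate f g on a chain n annihilated by
    M.  Permutation groups of infinite sets have no nontrivial characters on
    finitary elements, so the value depends only on the images under g of the points
    of n (finitary_char_trivial, eval_agree).  If a, b, c are points and n avoids c,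
    the sum of the values over the permutations g of {a,b,c} is an invariant functional
    of n; moving the remaining points to infinity along an ultrafilter shows that
    it is a multiple of the number of members of n containing a and b, so it vanishes
    (trace_eq0).  This is exactly what is needed for the iterated limits of the
    values of f, as the points of n are moved to infinity one at a time, to be
    independent of the order of the points (ilim_swap, avg_perm).  The limit is then
    equivariant up to f, which means that it is a primitive of f (avg_cocycle). *)

Set Implicit Arguments.
Unset Strict Implicit.
Unset Printing Implicit Defensive.

Import GRing.Theory.
Local Open Scope classical_set_scope.
Local Open Scope ring_scope.

(** * Arithmetic of Z_2 and Z_4 *)

Definition par (x : 'Z_4) : 'Z_2 := inZp (val x).
Definition dbl (x : 'Z_2) : 'Z_4 := inZp (2 * val x).
Definition lift01 (x : 'Z_2) : 'Z_4 := inZp (val x).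

Lemma Z2_addxx (x : 'Z_2) : x + x = 0.
Proof. by case: x => [[|[|n]] h]; apply: val_inj. Qed.

Lemma Z2_oppr (x : 'Z_2) : - x = x.
Proof. by case: x => [[|[|n]] h]; apply: val_inj. Qed.

Lemma Z2_add_eq0 (x y : 'Z_2) : (x + y == 0) = (x == y).
Proof. by rewrite -[y in x + y]Z2_oppr subr_eq0. Qed.

Lemma Z2_mulrn (x : 'Z_2) n : x *+ n = if odd n then x else 0.
Proof.
elim: n => [|n IH]; rewrite ?mulr0n // mulrS IH /=.
by case: (odd n); rewrite ?Z2_addxx ?addr0.
Qed.

Lemma Z2P (x : 'Z_2) : x = 0 \/ x = 1.
Proof. by case: x => [[|[|n]] h] //; [left|right]; apply: val_inj. Qed.

Lemma par_is_additive : additive par.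
Proof.
case=> [[|[|[|[|n]]]] h] // [[|[|[|[|m]]]] h'] //; exact: val_inj.
Qed.
HB.instance Definition _ := GRing.isAdditive.Build 'Z_4 'Z_2 par par_is_additive.

Lemma dbl_is_additive : additive dbl.
Proof. case=> [[|[|n]] h] // [[|[|m]] h'] //; exact: val_inj. Qed.
HB.instance Definition _ := GRing.isAdditive.Build 'Z_2 'Z_4 dbl dbl_is_additive.

Lemma par_dbl x : par (dbl x) = 0.
Proof. case: x => [[|[|n]] h] //; exact: val_inj. Qed.

Lemma par_lift01 x : par (lift01 x) = x.
Proof. case: x => [[|[|n]] h] //; exact: val_inj. Qed.

Lemma dbl_par x : dbl (par x) = x + x.
Proof. case: x => [[|[|[|[|n]]]] h] //; exact: val_inj. Qed.

Lemma dbl_inj : injective dbl.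
Proof. by case=> [[|[|n]] h] // [[|[|m]] h'] // /(congr1 val) /= H; apply: val_inj. Qed.

Definition half4 (x : 'Z_4) : 'Z_2 := inZp ((val x)./2).

Lemma dbl_half x : par x = 0 -> dbl (half4 x) = x.
Proof. by case: x => [[|[|[|[|n]]]] h] // /(congr1 val) //= _; apply: val_inj. Qed.

Lemma dbl_opp x : - dbl x = dbl x.
Proof. by rewrite -raddfN Z2_oppr. Qed.

(** * Limits and iterated limits of Z_2-valued functions *)

(** An ultrafilter refining F decides every two-valued function.  Later arguments
    only use that this limit is additive and sees eventually constant functions. *)
Lemma filter_limit (T : Type) (F : set_system T) : ProperFilter F ->
  exists lim : (T -> 'Z_2) -> 'Z_2,
    (forall f g, lim (fun x => f x + g x) = lim f + lim g) /\
    (forall f c, F [set x | f x = c] -> lim f = c).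
Proof.
move=> FF; have [U [UU FU]] := ultraFilterLemma FF.
exists (fun f => if pselect (U [set x | f x = 1]) then 1 else 0).
have lim_c (f : T -> 'Z_2) c : U [set x | f x = c] ->
    (if pselect (U [set x | f x = 1]) then 1 else 0 : 'Z_2) = c.
  move=> Uc; case: pselect => [U1|nU1]; case: (Z2P c) => c01; subst c => //.
    by have [x /= [->]] := filter_ex (filterI U1 Uc).
split; last by move=> f c /FU; apply: lim_c.
have limP (f : T -> 'Z_2) : exists c, U [set x | f x = c].
  have [?|nU] := in_ultra_setVsetC [set x | f x = 1] UU; first by exists 1.
  exists 0; apply: filterS nU => x /=; by case: (Z2P (f x)) => ->.
move=> f g; have [c Uc] := limP f; have [d Ud] := limP g.
rewrite (lim_c _ _ Uc) (lim_c _ _ Ud); apply: lim_c.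
by apply: filterS (filterI Uc Ud) => x /= [-> ->].
Qed.

Definition fresh (T : eqType) (D ys : seq T) := uniq ys && all [predC D] ys.

Lemma fresh_cons (T : eqType) (D ys : seq T) y :
  y \notin D -> fresh (y :: D) ys -> fresh D (y :: ys).
Proof.
move=> yD /andP[u /allP a]; apply/andP; split=> /=.
  by rewrite u andbT; apply/negP => /a /=; rewrite inE eqxx.
apply/andP; split=> //; apply/allP => z /a /=; by rewrite inE negb_or => /andP[].
Qed.

Fixpoint swap_at (T : Type) (i : nat) (ys : seq T) : seq T :=
  match i, ys with
  | 0, y :: y' :: s => y' :: y :: s
  | i'.+1, y :: s => y :: swap_at i' s
  | _, _ => ys
  end.

Lemma swap_at_cat (T : Type) (p : seq T) y z s :
  swap_at (size p) (p ++ y :: z :: s) = p ++ z :: y :: s.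
Proof. by elim: p => //= u p ->. Qed.

Lemma swap_at_map (T T' : Type) (h : T -> T') i s :
  swap_at i (map h s) = map h (swap_at i s).
Proof.
elim: i s => [|i IH] [|y s] //=; [by case: s|by rewrite IH].
Qed.

Section IteratedLimits.
Variable T : eqType.
Variable lim : (T -> 'Z_2) -> 'Z_2.
Hypothesis limD : forall f g, lim (fun x => f x + g x) = lim f + lim g.
Hypothesis lim_cst : forall (D : seq T) f c, (forall y, y \notin D -> f y = c) -> lim f = c.

Lemma lim_eq (D : seq T) f g : (forall y, y \notin D -> f y = g y) -> lim f = lim g.
Proof.
move=> fg; apply/eqP; rewrite -Z2_add_eq0 -limD; apply/eqP.
by apply: (lim_cst (D := D)) => y /fg ->; rewrite Z2_addxx.
Qed.

(** The first entry of the list belongs to the outermost limit. *)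
Fixpoint ilim (m : nat) (F : seq T -> 'Z_2) : 'Z_2 :=
  if m is m'.+1 then lim (fun y => ilim m' (fun ys => F (y :: ys))) else F [::].

Lemma ilim_eq m (D : seq T) F G :
  (forall ys, size ys = m -> fresh D ys -> F ys = G ys) -> ilim m F = ilim m G.
Proof.
elim: m D F G => [|m IH] D F G FG /=; first exact: FG.
apply: (lim_eq (D := D)) => y yD; apply: (IH (y :: D)) => ys sz fr.
by apply: FG; [rewrite /= sz|apply: fresh_cons].
Qed.

Lemma ilim_cst m (D : seq T) F c :
  (forall ys, size ys = m -> fresh D ys -> F ys = c) -> ilim m F = c.
Proof.
move=> Fc; rewrite (ilim_eq (D := D) (G := fun=> c)) //; elim: m {Fc} => //= m IH.
exact: (lim_cst (D := [::])).
Qed.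

Lemma ilimD m F G : ilim m (fun ys => F ys + G ys) = ilim m F + ilim m G.
Proof.
elim: m F G => [//|m IH] F G /=; rewrite -limD.
by apply: (lim_eq (D := [::])) => y _; apply: IH.
Qed.

Lemma ilim_sum m (I : Type) (n : seq I) (P : pred I) (F : I -> seq T -> 'Z_2) :
  ilim m (fun ys => \sum_(i <- n | P i) F i ys) = \sum_(i <- n | P i) ilim m (F i).
Proof.
elim: n => [|i n IH].
  by rewrite big_nil; apply: (ilim_cst (D := [::])) => ys _ _; rewrite big_nil.
rewrite big_cons -IH; case: (boolP (P i)) => Pi.
  rewrite -ilimD; apply: (ilim_eq (D := [::])) => ys _ _; by rewrite big_cons Pi.
apply: (ilim_eq (D := [::])) => ys _ _; by rewrite big_cons (negbTE Pi).
Qed.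

(** Entries that the mask drops are dummy variables, so the value depends only on
    the number of entries that are kept. *)
Lemma ilim_mask (mk : bitseq) F :
  ilim (size mk) (fun ys => F (mask mk ys)) = ilim (count id mk) F.
Proof.
elim: mk F => [//|b mk IH] F /=; case: b => /=.
  apply: (lim_eq (D := [::])) => y _; exact: (IH (fun ys => F (y :: ys))).
by rewrite add0n -(IH F); apply: (lim_cst (D := [::])).
Qed.

(** For H(y,y') the symmetrization of F in the two adjacent variables, the
    hypothesis is the cocycle identity H(y1,y2) + H(y2,y3) + H(y1,y3) = 0.  The
    iterated limit of each of the three terms is the same h, whence 3h = h = 0:
    the two limits commute. *)
Lemma ilim_swap m i (D : seq T) F :
    (forall p y1 y2 y3 s, size p = i -> (size p + size s).+2 = m ->
       fresh D (p ++ [:: y1; y2; y3] ++ s) ->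
     (F (p ++ [:: y1; y2] ++ s) + F (p ++ [:: y2; y1] ++ s)) +
     (F (p ++ [:: y2; y3] ++ s) + F (p ++ [:: y3; y2] ++ s)) +
     (F (p ++ [:: y1; y3] ++ s) + F (p ++ [:: y3; y1] ++ s)) = 0) ->
  (i.+2 <= m)%N -> ilim m (F \o swap_at i) = ilim m F.
Proof.
elim: i m D F => [|i IH] [//|m] D F F3 /= le_im; last first.
  apply: (lim_eq (D := D)) => y yD.
  apply: (IH m (y :: D) (fun ys => F (y :: ys))) => // p y1 y2 y3 s szp sz fr.
  apply: (F3 (y :: p)); rewrite /= ?szp -?sz ?szp //; exact: fresh_cons.
case: m le_im F3 => [//|m] _ F3 /=.
pose H y y' := ilim m (fun s => F [:: y, y' & s] + F [:: y', y & s]).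
have H3 y1 y2 y3 : y1 \notin D -> y2 \notin y1 :: D -> y3 \notin [:: y2, y1 & D] ->
    H y1 y2 + H y2 y3 + H y1 y3 = 0.
  move=> y1D y2D y3D; rewrite -!ilimD.
  apply: (ilim_cst (D := [:: y3, y2, y1 & D])) => s sz fr.
  apply: (F3 [::]) => //=; rewrite ?add0n ?sz //.
  by do 3!(apply: fresh_cons => //).
pose h := lim (fun y => lim (fun y' => H y y')).
have h0 : h = 0.
  have -> : h = h + h + h by rewrite Z2_addxx add0r.
  rewrite /h.
  have E12 : h = lim (fun y1 => lim (fun y2 => lim (fun y3 => H y1 y2))).
    apply: (lim_eq (D := [::])) => y1 _; apply: (lim_eq (D := [::])) => y2 _.
    by symmetry; apply: (lim_cst (D := [::])).
  have E13 : h = lim (fun y1 => lim (fun y2 => lim (fun y3 => H y1 y3))).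
    apply: (lim_eq (D := [::])) => y1 _.
    by symmetry; apply: (lim_cst (D := [::])).
  have E23 : h = lim (fun y1 => lim (fun y2 => lim (fun y3 => H y2 y3))).
    by symmetry; apply: (lim_cst (D := [::])).
  rewrite -/h {1}E12 {1}E23 {1}E13 -!limD.
  apply: (lim_cst (D := D)) => y1 y1D; rewrite -!limD.
  apply: (lim_cst (D := y1 :: D)) => y2 y2D; rewrite -!limD.
  by apply: (lim_cst (D := [:: y2, y1 & D])) => y3 y3D; apply: H3.
apply/eqP; rewrite -Z2_add_eq0 -h0 -limD; apply/eqP.
apply: (lim_eq (D := [::])) => y _; rewrite -limD.
apply: (lim_eq (D := [::])) => y' _.
by rewrite -ilimD; apply: (ilim_eq (D := [::])) => s _ _ /=; rewrite addrC.
Qed.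

End IteratedLimits.

(** * Finitary permutations and characters of infinite symmetric groups *)

Lemma sym_inj (T : Type) (g : SymGroup T) : injective g.
Proof. exact: can_inj (sym_funK g). Qed.
Lemma symVK (T : Type) (g : SymGroup T) x : (g^-1)%g (g x) = x.
Proof. exact: sym_funK. Qed.
Lemma symKV (T : Type) (g : SymGroup T) x : g ((g^-1)%g x) = x.
Proof. exact: sym_invK. Qed.

Section Permutations.
Variable Omega : choiceType.
Implicit Types (a b c x y z : Omega) (g h : SymGroup Omega).

Definition swap_fun a b x := if x == a then b else if x == b then a else x.

Lemma swap_funK a b : involutive (swap_fun a b).
Proof.
move=> x; rewrite /swap_fun; case: (eqVneq x a) => [->|xa].
  by rewrite eqxx; case: eqP.
case: (eqVneq x b) => [->|xb]; first by rewrite eqxx.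
by rewrite (negbTE xa) (negbTE xb).
Qed.

Definition swap a b : SymGroup Omega := MkSymGroup (@swap_funK a b) (@swap_funK a b).

Lemma swapL a b : swap a b a = b. Proof. by rewrite /= /swap_fun eqxx. Qed.
Lemma swapR a b : swap a b b = a.
Proof. by rewrite /= /swap_fun eqxx; case: eqP. Qed.
Lemma swapD a b x : x != a -> x != b -> swap a b x = x.
Proof. by rewrite /= /swap_fun => /negbTE-> /negbTE->. Qed.
Lemma swap2 a b : (swap a b * swap a b)%g = 1%g.
Proof. by apply/symP => x; rewrite symM /= swap_funK. Qed.
Lemma swapV a b : (swap a b)^-1%g = swap a b.
Proof. exact/symP. Qed.

Lemma swap_conj g a b : (swap a b * g = g * swap (g a) (g b))%g.
Proof.
apply/symP => x; rewrite !symM /= /swap_fun !(inj_eq (@sym_inj _ g)).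
by case: eqP => // _; case: eqP.
Qed.

Definition finitary g := exists S : seq Omega, forall x, x \notin S -> g x = x.

Lemma finitary_swap a b : finitary (swap a b).
Proof.
by exists [:: a; b] => x; rewrite !inE negb_or => /andP[xa xb]; apply: swapD.
Qed.

Lemma finitaryM g h : finitary g -> finitary h -> finitary (g * h)%g.
Proof.
move=> [S Sg] [S' Sh]; exists (S ++ S') => x.
by rewrite mem_cat negb_or symM => /andP[/Sg-> /Sh].
Qed.

Lemma finitaryV g : finitary g -> finitary g^-1%g.
Proof. by move=> [S Sg]; exists S => x xS; rewrite -{1}(Sg x xS) symVK. Qed.

Lemma finitary1 : finitary 1%g. Proof. by exists [::]. Qed.

Lemma finitary_map (L L' : seq Omega) : uniq L -> uniq L' -> size L = size L' ->
  exists2 g, finitary g & map g L = L'.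
Proof.
elim: L L' => [|x L IH] [|y L'] //; first by exists 1%g => //; exact: finitary1.
move=> /= /andP[xL uL] /andP[yL' uL'] [sz].
have [g fg gL] := IH _ uL uL' sz.
exists (g * swap (g x) y)%g; first exact/finitaryM/finitary_swap.
rewrite symM swapL; congr (_ :: _); rewrite -gL; apply/eq_in_map => z zL.
rewrite symM swapD //; first by rewrite (inj_eq (@sym_inj _ g)); apply: contraNneq xL => <-.
by apply: contraNneq yL' => <-; rewrite -gL map_f.
Qed.

Hypothesis Omega_infinite : infinite_set [set: Omega].

Lemma fresh_point (D : seq Omega) : exists y, y \notin D.
Proof.
apply: contrapT => nex; apply: Omega_infinite.
apply: (@sub_finite_set _ _ [set` D]); last exact: finite_seq.
by move=> y _ /=; apply: contrapT => yD; apply: nex; exists y; apply/negP.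
Qed.

Lemma fresh_points m (D : seq Omega) : exists2 ys, size ys = m & fresh D ys.
Proof.
elim: m D => [|m IH] D; first by exists [::].
have [y yD] := fresh_point D; have [ys sz fr] := IH (y :: D).
by exists (y :: ys); rewrite /= ?sz //; apply: fresh_cons.
Qed.

Lemma fresh_enum (D : seq Omega) :
  exists2 e : nat -> Omega, injective e & forall i, e i \notin D.
Proof.
have : infinite_set (~` [set` D]).
  move=> fin; apply: Omega_infinite; rewrite -(setvU [set` D]) finite_setU.
  by split=> //; exact: finite_seq.
move=> /infiniteP/card_leP[f].
pose c i : [set: nat] := exist _ i (mem_set I); exists (fun i => val (f (c i))).
  move=> i j /val_inj ij.
  by have [] := inj (f := f) (mem_set I) (mem_set I) ij.
by move=> i; apply/negP; exact: (set_mem (valP (f (c i)))).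
Qed.

(** The extension of s by the identity outside the image of e. *)
Lemma extend_along (T : Type) (e : T -> Omega) : injective e ->
  forall s : SymGroup T, exists2 g : SymGroup Omega, forall t, g (e t) = e (s t) &
    forall y, (forall t, e t <> y) -> g y = y.
Proof.
move=> e_inj; pose F (s : SymGroup T) y :=
  if pselect (exists t, e t = y) is left ex then e (s (sval (cid ex))) else y.
have Fe s t : F s (e t) = e (s t).
  rewrite /F; case: pselect => [ex|[]]; last by exists t.
  by congr (e (s _)); apply: e_inj; exact: (svalP (cid ex)).
have Fn s y : (forall t, e t <> y) -> F s y = y.
  by move=> ney; rewrite /F; case: pselect => // -[t ty]; case: (ney t).
have FK (s s' : SymGroup T) : cancel s s' -> cancel (F s) (F s').
  move=> ss' y; case: (pselect (exists t, e t = y)) => [[t <-]|nex].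
    by rewrite !Fe ss'.
  have ney t : e t <> y by move=> ty; apply: nex; exists t.
  by rewrite !(Fn _ _ ney).
move=> s.
exists (MkSymGroup (FK s s^-1%g (sym_funK s)) (FK s^-1%g s (sym_invK s)));
  [exact: Fe|exact: Fn].
Qed.

(** A swindle: place copies of g on the layers of an embedded int * S, the copy
    with index 0 being g on the set S of points that it moves.  Let P be the product
    of the copies with index at least 1 and s the shift of the layers; then
    s * P * s^-1 is the product of the copies with index at least 0.  No
    layer meets X, since g fixes X and the other layers are fresh. *)
Lemma finitary_commutator g (X : seq Omega) : finitary g ->
  (forall x, x \in X -> g x = x) ->
  exists P s : SymGroup Omega,
    [/\ forall x, x \in X -> P x = x, forall x, x \in X -> s x = x
      & g = (P^-1 * (s * P * s^-1))%g].
Proof.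
move=> [D gD] gX.
pose S : {fset Omega} := [fset x in [seq x <- D | g x != x]]%fset.
have SP x : (x \in S) = (g x != x).
  rewrite !inE mem_filter andb_idr //; apply: contraNT => /gD -> //.
have gS : [fset g x | x in S]%fset = S.
  apply/fsetP => y; apply/imfsetP/idP => [[x /= xS ->]|yS].
    by move: xS; rewrite !SP (inj_eq (@sym_inj _ g)).
  exists ((g^-1)%g y); rewrite ?symKV // SP symKV; apply: contraTneq yS => yE.
  by rewrite SP {1}yE symKV eqxx.
have [e e_inj eD] := fresh_enum (X ++ D).
pose r := restr_sym S g; have rE := restr_symE gS.
pose eT (t : int * S) : Omega := if t.1 == 0 then val t.2 else e (choice.pickle t).
have SD (x : S) : val x \in X ++ D.
  rewrite mem_cat orbC; have /= := fsvalP x; rewrite SP.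
  by apply: contraNT; rewrite negb_or => /andP[/gD->].
have eT_inj : injective eT.
  move=> [i x] [j y]; rewrite /eT /=; case: eqP => [->|_]; case: eqP => [->|_].
  - by move/val_inj->.
  - by move=> xe; have := eD (choice.pickle (j, y)); rewrite -xe SD.
  - by move=> xe; have := eD (choice.pickle (i, x)); rewrite xe SD.
  - by move/e_inj/(pcan_inj choice.pickleK).
have eX t x : x \in X -> eT t <> x.
  move=> xX; rewrite /eT; case: eqP => _ tx; last first.
    by have := eD (choice.pickle t); rewrite tx mem_cat xX.
  by have := fsvalP t.2; rewrite SP tx gX ?eqxx.
pose Pf (p : {perm S}) (t : int * S) := (t.1, if (1 <= t.1)%R then p t.2 else t.2).
have PfK p : cancel (Pf p) (Pf p^-1%g).
  by move=> [i x]; rewrite /Pf /=; case: (1 <= i)%R; rewrite ?permK.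
have PfKV p : cancel (Pf p^-1%g) (Pf p).
  by move=> [i x]; rewrite /Pf /=; case: (1 <= i)%R; rewrite ?permKV.
pose sf (k : int) (t : int * S) := (t.1 + k, t.2).
have sfK k : cancel (sf k) (sf (- k)) by move=> [i x]; rewrite /sf /= addrK.
have sfKV k : cancel (sf (- k)) (sf k) by move=> [i x]; rewrite /sf /= addrNK.
have [P PT Pn] := extend_along eT_inj (MkSymGroup (PfK r) (PfKV r)).
have [s sT sn] := extend_along eT_inj (MkSymGroup (sfK 1) (sfKV 1)).
exists P, s; split=> [x xX|x xX|]; [by apply: Pn => t; apply: eX|by apply: sn => t; apply: eX|].
suff E : (P * g)%g = (s * P * s^-1)%g by rewrite -E mulgA mulVg mul1g.
suff E : (P * g * s)%g = (s * P)%g by rewrite -E mulgK.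
apply/symP => y; rewrite !symM.
case: (pselect (exists t, eT t = y)) => [[[i x] <-]|nex]; last first.
  have ney t : eT t <> y by move=> ty; apply: nex; exists t.
  rewrite (sn _ ney) (Pn _ ney).
  have -> : g y = y.
    apply/eqP; rewrite -[_ == _]negbK -SP; apply/negP => yS.
    by apply: (ney (0, FSetSub yS)); rewrite /eT.
  by rewrite sn.
rewrite sT !PT /= /sf /Pf /=.
(* The layers other than that of index 0 avoid the finite set D. *)
have ge (j : int) (z : S) : j != 0 -> g (eT (j, z)) = eT (j, z).
  move=> j0; rewrite /eT /= (negbTE j0); apply: gD.
  by have := eD (choice.pickle (j, z)); rewrite mem_cat negb_or => /andP[].
case: (eqVneq i 0) => [->|i0].
  have -> : eT (0, x) = val x by [].
  by rewrite /= -[g (val x)]rE; rewrite -[val (r x)]/(eT (0, r x)) sT.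
rewrite ge // sT /= /sf /=; congr (eT (_, _)).
have -> : (1 <= i + 1)%R = (1 <= i)%R; last by [].
case: i i0 => [[|n]|n] //= _; by case: n.
Qed.

(** finitary_commutator writes g as the product of P^-1 and a conjugate of P, on
    which chi takes the same value. *)
Lemma finitary_char_trivial (X : seq Omega) (chi : SymGroup Omega -> 'Z_2) :
  (forall g h, (forall x, x \in X -> g x = x) -> (forall x, x \in X -> h x = x) ->
     chi (g * h)%g = chi g + chi h) ->
  forall g, finitary g -> (forall x, x \in X -> g x = x) -> chi g = 0.
Proof.
move=> chiM g fg gX; have [P [s [PX sX ->]]] := finitary_commutator fg gX.
have fV h : (forall x, x \in X -> h x = x) -> forall x, x \in X -> (h^-1)%g x = x.
  by move=> hX x xX; rewrite -{1}(hX _ xX) symVK.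
have fM h h' : (forall x, x \in X -> h x = x) -> (forall x, x \in X -> h' x = x) ->
    forall x, x \in X -> (h * h')%g x = x.
  by move=> hX h'X x xX; rewrite symM hX ?h'X.
have chi1 : chi 1%g = 0.
  by apply: (addrI (chi 1%g)); rewrite -chiM // mulg1 addr0.
have chiV h : (forall x, x \in X -> h x = x) -> chi h^-1%g = chi h.
  move=> hX; apply/eqP; rewrite -Z2_add_eq0 -chiM //; last exact: fV.
  by rewrite mulVg chi1.
have PV := fV _ PX; have sV := fV _ sX; have sP := fM _ _ sX PX.
have sPs := fM _ _ sP sV.
rewrite chiM // (chiM (s * P)%g) // chiM // !chiV //.
by rewrite [chi s + _]addrC -[_ + chi s + chi s]addrA Z2_addxx addr0 Z2_addxx.
Qed.

End Permutations.

(** * The action on k-subsets *)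

Section KsetAction.
Variables (Omega : choiceType) (k : nat).
Implicit Types (a b c x y z : Omega) (g h : SymGroup Omega) (w : kset Omega k).

Lemma kset_imM g h w : kset_im (g * h)%g w = kset_im h (kset_im g w).
Proof.
apply/val_inj/fsetP => x /=; apply/imfsetP/imfsetP => /= -[y yw ->].
  by exists (g y) => //; apply/imfsetP; exists y.
by have /imfsetP[z /= zw ->] := yw; exists z.
Qed.

Lemma kset_im_fix g w : (forall x, x \in val w -> g x = x) -> kset_im g w = w.
Proof.
move=> gw; apply/val_inj/fsetP => x /=; apply/imfsetP/idP => /= [[y yw ->]|xw].
  by rewrite gw.
by exists x; rewrite ?gw.
Qed.

Lemma kset_im1 w : kset_im 1%g w = w. Proof. exact: kset_im_fix. Qed.

Lemma mem_kset_im g w x : (g x \in val (kset_im g w)) = (x \in val w).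
Proof.
apply/imfsetP/idP => /= [[y yw /(@sym_inj _ g) ->] //|xw]; by exists x.
Qed.

Lemma mem_kset_imV g w x : (x \in val (kset_im g w)) = ((g^-1)%g x \in val w).
Proof. by rewrite -[RHS](mem_kset_im g) symKV. Qed.

Lemma kset_im_eq g h w : (forall x, x \in val w -> g x = h x) ->
  kset_im g w = kset_im h w.
Proof.
move=> gh; have -> : h = (g * (g^-1 * h))%g by rewrite mulgA mulgV mul1g.
rewrite kset_imM [RHS]kset_im_fix // => x; rewrite mem_kset_imV symM => /gh <-.
by rewrite symKV.
Qed.

Lemma kset_imVK g w : kset_im g^-1%g (kset_im g w) = w.
Proof. by rewrite -kset_imM mulgV kset_im1. Qed.

Lemma kset_imKV g w : kset_im g (kset_im g^-1%g w) = w.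
Proof. by rewrite -kset_imM mulVg kset_im1. Qed.

Lemma kset_im_swap a b w : (a \in val w) = (b \in val w) -> kset_im (swap a b) w = w.
Proof.
move=> ab; apply/val_inj/fsetP => x; rewrite mem_kset_imV /= /swap_fun.
by case: eqP => [->|_]; [|case: eqP => [->|]].
Qed.

Lemma card_kset w : size (enum_fset (val w)) = k.
Proof. exact/eqP/(valP w). Qed.

Lemma kset_transitive (w0 w : kset Omega k) : exists g, kset_im g w0 = w.
Proof.
have [g _ gE] := finitary_map (fset_uniq (val w0)) (fset_uniq (val w))
  (etrans (card_kset w0) (esym (card_kset w))).
exists g; apply/val_inj/fsetP => x; apply/imfsetP/idP => /= [[y yw ->]|].
  by rewrite -[_ \in _]/(g y \in enum_fset (val w)) -gE map_f.
by rewrite -[_ \in _]/(x \in enum_fset (val w)) -gE => /mapP[y yw ->]; exists y.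
Qed.

End KsetAction.

(** * Chains of k-subsets and annihilators *)

(** Double annihilators over Z_2 for functions on a finite list s: a function
    that differs on s from every member of the subgroup V is separated from V by a
    sum over some list n.  The induction removes a point x from s and replaces V by
    its members that vanish at x. *)
Lemma separating_chain (T : eqType) (V : (T -> 'Z_2) -> Prop) (s : seq T) (F : T -> 'Z_2) :
  (forall f g, V f -> V g -> V (fun x => f x + g x)) -> V (fun=> 0) ->
  (forall f, V f -> exists2 x, x \in s & f x != F x) ->
  exists n : seq T, [/\ {subset n <= s}, forall f, V f -> \sum_(x <- n) f x = 0
                      & \sum_(x <- n) F x = 1].
Proof.
elim: s V F => [|x s IH] V F VD V0 VF; first by have [] := VF _ V0.
case: (pselect (exists2 v, V v & v x = 1)) => [[v1 Vv1 v1x]|nv1]; last first.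
  have Vx f : V f -> f x = 0.
    by move=> Vf; case: (Z2P (f x)) => // fx; case: nv1; exists f.
  case: (Z2P (F x)) => Fx; last first.
    exists [:: x]; split=> [y|f Vf|]; last by rewrite big_seq1.
      by rewrite !inE => ->.
    by rewrite big_seq1 Vx.
  have [|n [ns Vn Fn]] := IH V F VD V0.
    move=> f Vf; have [y + yF] := VF f Vf; rewrite inE => /predU1P[yx|]; last by exists y.
    by rewrite yx Fx (Vx f Vf) eqxx in yF.
  by exists n; split=> // y /ns; rewrite inE orbC => ->.
wlog Fx : F VF / F x = 0.
  move=> W; case: (Z2P (F x)) => Fx; first exact: W.
  have [|| n [ns Vn Fn]] := W (fun y => F y + v1 y); last first.
  - exists n; split=> //; move: Fn; by rewrite big_split /= (Vn v1) // addr0.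
  - by rewrite Fx v1x Z2_addxx.
  move=> f Vf; have [y ys yF] := VF _ (VD _ _ Vf Vv1); exists y => //.
  apply: contraNneq yF => ->; by rewrite -addrA Z2_addxx addr0.
have [||| n [ns Vn Fn]] := IH (fun f => V f /\ f x = 0) F.
- by move=> f g [Vf fx] [Vg gx]; split; [exact: VD|rewrite fx gx addr0].
- by split.
- move=> f [Vf fx]; have [y + yF] := VF f Vf; rewrite inE => /predU1P[yx|]; last by exists y.
  by rewrite yx Fx fx eqxx in yF.
have Vv1n f : V f -> \sum_(y <- n) f y = (if f x == 1 then \sum_(y <- n) v1 y else 0).
  move=> Vf; case: (Z2P (f x)) => fx; rewrite fx /=; first exact: Vn.
  apply/eqP; rewrite -Z2_add_eq0 -big_split /=; apply/eqP; apply: Vn.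
  by split; [exact: VD|rewrite fx v1x Z2_addxx].
case: (Z2P (\sum_(y <- n) v1 y)) => v1n.
  exists n; split=> // [y /ns|f Vf]; first by rewrite inE orbC => ->.
  by rewrite Vv1n // v1n; case: ifP.
exists (x :: n); split=> [y|f Vf|]; last by rewrite big_cons Fx add0r.
  by rewrite !inE => /orP[->//|/ns ->]; rewrite orbT.
rewrite big_cons Vv1n // v1n; case: (Z2P (f x)) => fx; rewrite fx /=.
  by rewrite addr0.
exact: Z2_addxx.
Qed.

Section Chains.
Variables (Omega : choiceType) (l : nat).
Implicit Types (a b c x y z : Omega) (g h : SymGroup Omega) (w : kset Omega l).
Implicit Types (n : seq (kset Omega l)) (F : kset Omega l -> 'Z_2).

(** A list of k-subsets stands for the finite formal sum of its entries with
    coefficients in Z_2; ev is the pairing of functions with such chains. *)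
Definition ev F n : 'Z_2 := \sum_(w <- n) F w.

Definition csupp n : seq Omega := flatten [seq enum_fset (val w) | w <- n].

Lemma csuppP n w x : w \in n -> x \in val w -> x \in csupp n.
Proof. by move=> wn xw; apply/flattenP; exists (enum_fset (val w)) => //; apply: map_f. Qed.

Lemma csuppN n w x : x \notin csupp n -> w \in n -> x \notin val w.
Proof. by move=> xn wn; apply: contra xn; apply: csuppP. Qed.

Lemma csupp_map g n x : x \in csupp (map (kset_im g) n) -> (g^-1)%g x \in csupp n.
Proof.
move=> /flattenP[_ /mapP[_ /mapP[w wn ->] ->]] xw.
by apply: csuppP wn _; rewrite -mem_kset_imV.
Qed.

Lemma ev_map F g n : ev F (map (kset_im g) n) = ev (fun w => F (kset_im g w)) n.
Proof. by rewrite /ev big_map. Qed.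

Lemma evD F G n : ev (fun w => F w + G w) n = ev F n + ev G n.
Proof. exact: big_split. Qed.

Lemma ev0 F n : (forall w, w \in n -> F w = 0) -> ev F n = 0.
Proof. by move=> F0; apply: big1_seq => w /andP[_ /F0]. Qed.

Lemma map_kset_im_fix g n : (forall x, x \in csupp n -> g x = x) ->
  map (kset_im g) n = n.
Proof.
move=> gn; rewrite -[RHS]map_id; apply/eq_in_map => w wn.
by apply: kset_im_fix => x xw; apply: gn; apply: csuppP xw.
Qed.

(** The second difference of F at w along two transpositions.  If w consists of
    a, b and a set u, it is the sum of F over the four terms of (a + a')(b + b')u. *)
Definition cross a b a' b' F w : 'Z_2 :=
  F w + F (kset_im (swap a a') w)
  + (F (kset_im (swap b b') w) + F (kset_im (swap b b') (kset_im (swap a a') w))).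

(** If w misses a, the transposition of a and the fresh a' fixes w, and the four
    terms cancel in pairs; likewise for b. *)
Lemma cross0 a b a' b' F w : uniq [:: a; b; a'; b'] -> a' \notin val w ->
  b' \notin val w -> ~~ ((a \in val w) && (b \in val w)) -> cross a b a' b' F w = 0.
Proof.
rewrite /= !inE !negb_or => /and4P[/and3P[ab aa' ab'] /andP[ba' bb'] a'b' _] a'w b'w.
rewrite negb_and => /orP[aw|bw]; rewrite /cross.
  by rewrite (@kset_im_swap _ _ a a') ?(negbTE aw) ?(negbTE a'w) // !Z2_addxx.
rewrite (@kset_im_swap _ _ b b' w) ?(negbTE bw) ?(negbTE b'w) //.
rewrite (@kset_im_swap _ _ b b') ?Z2_addxx //.
by rewrite !mem_kset_imV !swapD ?(negbTE bw) ?(negbTE b'w) // eq_sym.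
Qed.

Lemma ev_cross a b a' b' F n : uniq [:: a; b; a'; b'] -> a' \notin csupp n ->
  b' \notin csupp n ->
  ev (cross a b a' b' F) n
  = \sum_(w <- n | (a \in val w) && (b \in val w)) cross a b a' b' F w.
Proof.
move=> u a'n b'n; rewrite big_mkcond /ev big_seq [RHS]big_seq.
by apply: eq_bigr => w wn; case: ifPn => // nab; apply: cross0 => //; apply: csuppN wn.
Qed.

Lemma ev_crossE a b a' b' F n : ev (cross a b a' b' F) n =
  ev F n + ev F (map (kset_im (swap a a')) n)
  + (ev F (map (kset_im (swap b b')) n)
     + ev F (map (kset_im (swap b b')) (map (kset_im (swap a a')) n))).
Proof. by rewrite !ev_map !evD. Qed.

End Chains.

(** * Evaluating a cocycle on annihilating chains *)

Section Cohomology.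
Variables (Omega : choiceType) (l : nat).
Hypothesis Omega_infinite : infinite_set [set: Omega].
Implicit Types (a b c x y z : Omega) (g h : SymGroup Omega) (w : kset Omega l).
Implicit Types (n : seq (kset Omega l)) (F : kset Omega l -> 'Z_2).

Variable M : (kset Omega l -> 'Z_2) -> Prop.
Hypothesis MG : forall g m, M m -> M (fun w => m (kset_im g w)).

(** M is a module of functions, and f below is a 1-cocycle modulo M.  On chains that
    M annihilates the values of f obey the cocycle law exactly. *)
Definition ann n := forall m, M m -> ev m n = 0.

Hypothesis ann_even : forall n, ann n -> forall a b, a != b ->
  ~~ odd (count (fun w => (a \in val w) && (b \in val w)) n).

Lemma ann_map g n : ann n -> ann (map (kset_im g) n).
Proof. by move=> Nn m Mm; rewrite ev_map; apply/Nn/MG. Qed.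

Variable f : SymGroup Omega -> kset Omega l -> 'Z_2.
Hypothesis fM : forall g h, M (fun w => f g w + f h (kset_im g w) + f (g * h)%g w).

Definition eval g n := ev (f g) n.

Lemma eval_mul g h n : ann n -> eval (g * h)%g n = eval g n + eval h (map (kset_im g) n).
Proof.
move=> Nn; apply/eqP; rewrite eq_sym -Z2_add_eq0 /eval ev_map -!evD; apply/eqP.
exact: (Nn _ (fM g h)).
Qed.

(** On the pointwise stabilizer of the points of n, evaluation at n is a
    homomorphism into Z_2, hence trivial on finitary elements. *)
Lemma eval_fix g n : ann n -> finitary g -> (forall x, x \in csupp n -> g x = x) -> eval g n = 0.
Proof.
move=> Nn fg gn; apply: (finitary_char_trivial Omega_infinite (chi := eval^~ n) _ fg gn).
by move=> h h' hn h'n; rewrite eval_mul // map_kset_im_fix.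
Qed.

(** Evaluation at n depends only on where g sends the points of n.  This is what
    makes limits over the images of these points meaningful. *)
Lemma eval_agree g h n : ann n -> finitary g -> finitary h ->
  (forall x, x \in csupp n -> g x = h x) -> eval g n = eval h n.
Proof.
move=> Nn fg fh gh; have -> : h = (g * (g^-1 * h))%g by rewrite mulgA mulgV mul1g.
rewrite eval_mul // (eval_fix (ann_map g Nn)) ?addr0 //.
  by apply: finitaryM => //; apply: finitaryV.
by move=> x /csupp_map xn; rewrite symM -gh // symKV.
Qed.

Section Trace.
Variables (a b c : Omega).

Let t1 := swap a b.
Let t2 := swap b c.
Let t3 := swap a c.

Definition sym3 : seq (SymGroup Omega) := [:: 1; t1; t2; t1 * t2; t2 * t1; t3]%g.

Hypothesis abc : uniq [:: a; b; c].

Let ab : a != b. Proof. by move: abc; rewrite /= !inE negb_or => /andP[/andP[]]. Qed.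
Let ac : a != c. Proof. by move: abc; rewrite /= !inE negb_or => /andP[/andP[]]. Qed.
Let bc : b != c. Proof. by move: abc; rewrite /= !inE => /and3P[]. Qed.

Let t121 : (t1 * t2 * t1)%g = t3.
Proof. by rewrite -mulgA (swap_conj t1 b c) swapR swapD 1?eq_sym // mulgA swap2 mul1g. Qed.

Let t13 : (t3 * t1)%g = (t1 * t2)%g.
Proof. by rewrite -t121 -mulgA swap2 mulg1. Qed.

Let t212 : (t2 * t1 * t2)%g = t3.
Proof. by rewrite -mulgA (swap_conj t2 a b) swapL swapD // mulgA swap2 mul1g. Qed.

Let t23 : (t3 * t2)%g = (t2 * t1)%g.
Proof. by rewrite -t212 -mulgA swap2 mulg1. Qed.

(** The six elements split into three cosets of the subgroup generated by t. *)
Let sym3_pair (V : SymGroup Omega -> 'Z_2) t : t \in [:: t1; t2; t3] ->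
  (forall g, V (t * g)%g = V g) -> \sum_(g <- sym3) V g = 0.
Proof.
rewrite !inE !big_cons big_nil => /or3P[] /eqP-> tV.
- have V1 := tV 1%g; have V2 := tV t2; have V3 := tV (t2 * t1)%g.
  rewrite mulgA t121 in V3; rewrite mulg1 in V1.
  rewrite V1 V2 V3 addr0; move: (V 1%g) (V t2) (V (t2 * t1)%g) => u v s.
  by case: (Z2P u) => ->; case: (Z2P v) => ->; case: (Z2P s) => ->; apply: val_inj.
- have V1 := tV 1%g; have V2 := tV t1; have V3 := tV (t1 * t2)%g.
  rewrite mulgA t212 in V3; rewrite mulg1 in V1.
  rewrite V1 V2 V3 addr0; move: (V 1%g) (V t1) (V (t1 * t2)%g) => u v s.
  by case: (Z2P u) => ->; case: (Z2P v) => ->; case: (Z2P s) => ->; apply: val_inj.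
- have V1 := tV 1%g; have V2 := tV t1; have V3 := tV t2.
  rewrite t13 in V2; rewrite t23 in V3; rewrite mulg1 in V1.
  rewrite V1 V2 V3 addr0; move: (V 1%g) (V t1) (V t2) => u v s.
  by case: (Z2P u) => ->; case: (Z2P v) => ->; case: (Z2P s) => ->; apply: val_inj.
Qed.

(** A set that does not contain all of a, b, c meets {a,b,c} in a set that is fixed by
    one of the three transpositions. *)
Lemma sym3_orbit F w : ~~ [&& a \in val w, b \in val w & c \in val w] ->
  \sum_(g <- sym3) F (kset_im g w) = 0.
Proof.
move=> nabc.
have [t tG tw] : exists2 t, t \in [:: t1; t2; t3] & kset_im t w = w.
  case: (boolP ((a \in val w) == (b \in val w))) => [/eqP e|abw].
    by exists t1; [rewrite !inE eqxx|apply: kset_im_swap].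
  case: (boolP ((b \in val w) == (c \in val w))) => [/eqP e|bcw].
    by exists t2; [rewrite !inE eqxx orbT|apply: kset_im_swap].
  exists t3; first by rewrite !inE eqxx !orbT.
  by apply: kset_im_swap; move: abw bcw; do 3!case: (_ \in val w).
by apply: (sym3_pair tG) => g; rewrite kset_imM tw.
Qed.

(** The sum of the cocycle over the symmetric group of {a,b,c}.  For chains n that
    avoid c it is a functional invariant under permutations fixing a, b, c, because
    the orbit sum of such a chain vanishes. *)
Definition trace n := \sum_(g <- sym3) eval g n.

Lemma sym3_finitary g : g \in sym3 -> finitary g.
Proof.
have f1 := finitary_swap a b; have f2 := finitary_swap b c; have f3 := finitary_swap a c.
rewrite !inE => /or4P[/eqP->|/eqP->|/eqP->|/or3P[/eqP->|/eqP->|/eqP->]] //.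
- exact: finitary1.
- exact: finitaryM.
- exact: finitaryM.
Qed.

Lemma trace_ev n : trace n = ev (fun w => \sum_(g <- sym3) f g w) n.
Proof. by rewrite /trace /eval /ev exchange_big. Qed.

(** The extra term of the cocycle law is the value of X on the orbit sum of n. *)
Lemma trace_translate n (X : SymGroup Omega) : ann n -> c \notin csupp n ->
  \sum_(g <- sym3) eval (g * X)%g n = trace n.
Proof.
move=> Nn cn.
have -> : \sum_(g <- sym3) eval (g * X)%g n = \sum_(g <- sym3) (eval g n + eval X (map (kset_im g) n)).
  by apply: eq_bigr => g _; rewrite eval_mul.
rewrite big_split /= -[RHS]addr0; congr (_ + _).
have -> : \sum_(g <- sym3) eval X (map (kset_im g) n) = ev (fun w => \sum_(g <- sym3) f X (kset_im g w)) n.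
  by rewrite /ev exchange_big /=; apply: eq_bigr => g _; rewrite /eval ev_map.
apply: ev0 => w wn; apply: sym3_orbit.
by rewrite (negbTE (csuppN cn wn)) !andbF.
Qed.

Lemma trace_map h n : ann n -> c \notin csupp n ->
  h a = a -> h b = b -> h c = c -> trace (map (kset_im h) n) = trace n.
Proof.
move=> Nn cn ha hb hc.
have swap_comm y z : h y = y -> h z = z -> (swap y z * h = h * swap y z)%g.
  by move=> hy hz; rewrite swap_conj hy hz.
have sym3_comm g : g \in sym3 -> (g * h = h * g)%g.
  have c1 := swap_comm _ _ ha hb; have c2 := swap_comm _ _ hb hc.
  have c3 := swap_comm _ _ ha hc.
  rewrite !inE => /or4P[/eqP->|/eqP->|/eqP->|/or3P[/eqP->|/eqP->|/eqP->]] //.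
  - by rewrite mulg1 mul1g.
  - by rewrite -mulgA c2 !mulgA c1.
  - by rewrite -mulgA c1 !mulgA c2.
have := trace_translate h Nn cn; rewrite [X in X = _]big_seq.
have -> : \sum_(g <- sym3 | g \in sym3) eval (g * h)%g n =
          \sum_(g <- sym3 | g \in sym3) (eval h n + eval g (map (kset_im h) n)).
  by apply: eq_bigr => g /sym3_comm->; rewrite eval_mul.
rewrite -big_seq big_split /= -/(trace _) => <-.
suff -> : \sum_(g <- sym3) eval h n = 0 by rewrite add0r.
by rewrite !big_cons big_nil; case: (Z2P (eval h n)) => ->; apply: val_inj.
Qed.

(** A chain that avoids two of the three points is fixed by their transposition. *)
Lemma trace_kill n : ann n -> c \notin csupp n ->
  (a \notin csupp n) || (b \notin csupp n) -> trace n = 0.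
Proof.
move=> Nn cn abn.
have [y [t tG [tE yn]]] : exists y, exists2 t, t \in [:: t1; t2; t3] &
    t = swap y c /\ y \notin csupp n.
  by case/orP: abn => [an|bn]; [exists a, t3|exists b, t2];
    rewrite ?inE ?eqxx ?orbT.
have tn x : x \in csupp n -> t x = x.
  move=> xn; rewrite tE swapD //; first by apply: contraNneq yn => <-.
  by apply: contraNneq cn => <-.
apply: (sym3_pair tG) => g; rewrite eval_mul // map_kset_im_fix // eval_fix ?add0r //.
by rewrite tE; apply: finitary_swap.
Qed.

End Trace.

Variable lim : (Omega -> 'Z_2) -> 'Z_2.
Hypothesis limD : forall u v : Omega -> 'Z_2, lim (fun x => u x + v x) = lim u + lim v.
Hypothesis lim_cst : forall (D : seq Omega) (u : Omega -> 'Z_2) e,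
  (forall y, y \notin D -> u y = e) -> lim u = e.

(** Replacing n by its second difference along two transpositions with fresh a'
    and b' does not change the trace, so only the members that contain a and b
    count.  By invariance their other points may be moved to infinity along the
    iterated limit; there every such member contributes the same constant, since
    the limit ignores the points that do not belong to it.  The trace is therefore
    this constant times the number of members containing a and b, which is even. *)
Lemma trace_eq0 a b c n : uniq [:: a; b; c] -> ann n -> c \notin csupp n ->
  trace a b c n = 0.
Proof.
move=> abc Nn cn.
have [[|a' [|b' [|? ?]]] //= _ fr] := fresh_points Omega_infinite 2 ([:: a; b; c] ++ csupp n).
have {fr} [ub a'n b'n] :
    [/\ uniq [:: a; b; c; a'; b'], a' \notin csupp n & b' \notin csupp n].
  move: fr abc; rewrite /fresh /= !inE !negb_or.
  move=> /and4P[/andP[-> _] /and4P[a'a a'b a'c ->] /and4P[b'a b'b b'c ->] _].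
  move=> /and3P[/andP[-> ->] -> _].
  by rewrite ![_ == a']eq_sym ![_ == b']eq_sym a'a a'b a'c b'a b'b b'c.
have uabab : uniq [:: a; b; a'; b'].
  move: ub; rewrite /= !inE !negb_or.
  by move=> /and5P[/and4P[-> _ -> ->] /and3P[_ -> ->] _ -> _].
pose r := fun w => \sum_(g <- sym3 a b c) f g w.
pose R := cross a b a' b' r.
have traceR n' : ann n' -> c \notin csupp n' -> a' \notin csupp n' -> b' \notin csupp n' ->
    trace a b c n' = \sum_(w <- n' | (a \in val w) && (b \in val w)) R w.
  move=> Nn' cn' a'n' b'n'; rewrite -ev_cross // ev_crossE -!trace_ev.
  move: ub; rewrite /= !inE !negb_or.
  move=> /and5P[/and4P[ab ac aa' ab'] /and3P[bc ba' bb'] /andP[ca' cb'] a'b' _].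
  have nin y y' z n1 : z != y -> z != y' -> z \notin csupp n1 ->
      z \notin csupp (map (kset_im (swap y y')) n1).
    by move=> zy zy'; apply: contra => /csupp_map; rewrite swapV swapD.
  have ninL y y' n1 : y' \notin csupp n1 -> y \notin csupp (map (kset_im (swap y y')) n1).
    by apply: contra => /csupp_map; rewrite swapV swapL.
  have k1 : trace a b c (map (kset_im (swap a a')) n') = 0.
    apply: (trace_kill abc); [exact: ann_map|by apply: nin => //; rewrite eq_sym|].
    by rewrite ninL.
  have k2 : trace a b c (map (kset_im (swap b b')) n') = 0.
    apply: (trace_kill abc); [exact: ann_map|by apply: nin => //; rewrite eq_sym|].
    by rewrite ninL ?orbT.
  have k3 : trace a b c (map (kset_im (swap b b')) (map (kset_im (swap a a')) n')) = 0.
    apply: (trace_kill abc); first by do 2!apply: ann_map.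
      apply: (nin b b') => //; rewrite 1?eq_sym //; apply: (nin a a') => //; by rewrite eq_sym.
    by apply/orP; left; apply: (nin b b') => //; apply: ninL.
  by rewrite k1 k2 k3 !addr0.
(* The points of n to be moved to infinity; those of base stay fixed. *)
pose Z := [seq x <- undup (csupp n) | (x != a) && (x != b)].
have uZ : uniq Z by rewrite filter_uniq ?undup_uniq.
pose base := [:: a; b; c; a'; b'].
have ubZ : uniq (base ++ Z).
  rewrite cat_uniq ub uZ andbT; apply/hasPn => x; rewrite mem_filter mem_undup.
  move=> /andP[/andP[xa xb] xn]; rewrite !inE (negbTE xa) (negbTE xb) /=.
  by apply/negP => /or3P[] /eqP xE; move: cn a'n b'n; rewrite -xE xn.
(* R w depends on the points of w only, so it can be read off the list t of its
   points other than a and b; 0 is the value at lists that give no l-subset. *)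
pose R' (A : {fset Omega}) : 'Z_2 := if insub A is Some w then R w else 0.
pose Rt (t : seq Omega) := R' ([fset x in [:: a, b & t]]%fset).
pose mk w := [seq x \in val w | x <- Z].
have key ys : size ys = size Z -> fresh base ys ->
    trace a b c n = \sum_(w <- n | (a \in val w) && (b \in val w)) Rt (mask (mk w) ys).
  move=> sz /andP[uys /allP ysb].
  have uby : uniq (base ++ ys).
    by rewrite cat_uniq ub uys andbT; apply/hasPn => x /ysb.
  have [h fh hbZ] : exists2 h, finitary h & map h (base ++ Z) = base ++ ys.
    by apply: finitary_map => //; rewrite !size_cat sz.
  move: hbZ; rewrite map_cat => /eqP; rewrite eqseq_cat // => /andP[/eqP hb /eqP hZ].
  move: (hb) => [ha hb' hc ha' hb''].
  have hN z : h z = z -> z \notin csupp n -> z \notin csupp (map (kset_im h) n).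
    by move=> hz; apply: contra => /csupp_map; rewrite -{1}hz symVK.
  rewrite -(trace_map abc Nn cn ha hb' hc) traceR ?hN //; last exact: ann_map.
  rewrite big_map; rewrite (eq_bigl (fun w => (a \in val w) && (b \in val w))); last first.
    by move=> w; rewrite -{1}ha -{1}hb' !mem_kset_im.
  rewrite big_seq_cond [RHS]big_seq_cond; apply: eq_bigr => w /andP[wn /andP[aw bw]].
  have mE : mask (mk w) ys = map h [seq x <- Z | x \in val w].
    by rewrite -hZ -map_mask filter_mask.
  rewrite /Rt mE /R'.
  have -> : [fset x in [:: a, b & map h [seq x <- Z | x \in val w]]]%fset = val (kset_im h w).
    apply/fsetP => x; rewrite !inE -{1}ha -{1}hb'; apply/idP/idP.
      move=> /or3P[/eqP->|/eqP->|/mapP[z + ->]]; rewrite ?mem_kset_im //.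
      by rewrite mem_filter => /andP[].
    move=> /imfsetP[z /= zw ->]; rewrite !(inj_eq (@sym_inj _ h)).
    case: (eqVneq z a) => //= za; case: (eqVneq z b) => //= zb.
    by apply: map_f; rewrite mem_filter zw mem_filter za zb mem_undup (csuppP wn).
  by rewrite valK.
transitivity (ilim lim (size Z) (fun=> trace a b c n)).
  by symmetry; apply: (ilim_cst limD lim_cst (D := [::])).
rewrite (ilim_eq limD lim_cst key) ilim_sum //.
rewrite big_seq_cond.
have cst w : (w \in n) && ((a \in val w) && (b \in val w)) ->
    ilim lim (size Z) (fun ys => Rt (mask (mk w) ys)) = ilim lim l.-2 Rt.
  move=> /andP[wn /andP[aw bw]].
  have -> : size Z = size (mk w) by rewrite size_map.
  rewrite ilim_mask //; congr (ilim lim _ _).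
  rewrite count_map (eq_count (a2 := fun x => x \in val w)) //.
  rewrite -size_filter; set s := [seq x <- Z | x \in val w].
  suff : size (a :: b :: s) = l by move=> <-.
  rewrite -(card_kset w); apply/perm_size/uniq_perm.
  - rewrite /= !inE filter_uniq // andbT negb_or.
    rewrite !mem_filter !eqxx /= !andbF !andbT.
    by move: uabab => /= /and3P[]; rewrite !inE negb_or => /andP[].
  - exact: fset_uniq.
  move=> x; rewrite !inE mem_filter mem_filter mem_undup.
  case: (eqVneq x a) => [->|xa] /=; first by rewrite aw.
  case: (eqVneq x b) => [->|xb] /=; first by rewrite bw.
  by case xw: (x \in val w) => //=; apply: (csuppP wn).
rewrite (eq_bigr _ cst) -big_seq_cond big_const_seq iter_addr_0 Z2_mulrn ifN //.
apply: ann_even => //; by move: uabab => /= /and3P[]; rewrite !inE negb_or => /andP[].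
Qed.

Lemma permutation_choice : exists place : seq Omega -> seq Omega -> SymGroup Omega,
  forall L ys, uniq L -> uniq ys -> size L = size ys ->
    finitary (place L ys) /\ map (place L ys) L = ys.
Proof.
have ex (p : seq Omega * seq Omega) : exists place : SymGroup Omega,
    uniq p.1 -> uniq p.2 -> size p.1 = size p.2 -> finitary place /\ map place p.1 = p.2.
  case: (pselect [/\ uniq p.1, uniq p.2 & size p.1 = size p.2]) => [[u1 u2 sz]|nu].
    by have [place fX XE] := finitary_map u1 u2 sz; exists place.
  by exists 1%g => u1 u2 sz; case: nu.
have [place placeP] := choice ex.
by exists (fun L ys => place (L, ys)) => L ys; apply: (placeP (L, ys)).
Qed.

Variable place : seq Omega -> seq Omega -> SymGroup Omega.
Hypothesis placeP : forall L ys, uniq L -> uniq ys -> size L = size ys ->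
    finitary (place L ys) /\ map (place L ys) L = ys.

(** The limit of the cocycle as the points of L are moved to infinity one after
    the other; place L ys is a finitary permutation taking L to ys. *)
Definition avg L n := ilim lim (size L) (fun ys => eval (place L ys) n).
Definition avg_fun (L : seq Omega) w := ilim lim (size L) (fun ys => f (place L ys) w).

Lemma ev_avg_fun L n : ev (avg_fun L) n = avg L n.
Proof. by rewrite /ev -ilim_sum. Qed.

Lemma eval_place L ys g n : ann n -> uniq L -> {subset csupp n <= L} -> finitary g ->
  map g L = ys -> eval g n = eval (place L ys) n.
Proof.
move=> Nn uL nL fg gL.
have [fX XL] : finitary (place L ys) /\ map (place L ys) L = ys.
  by apply: placeP; rewrite // -gL ?size_map // map_inj_uniq //; apply: sym_inj.
apply: eval_agree => // x /nL xL.
by have /eq_in_map := etrans gL (esym XL) => /(_ x xL).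
Qed.

(** Adding a third fresh point c to x and y, the vanishing of the trace at every
    placement of the points is the three-term identity of the symmetrized
    function that makes the two limits commute. *)
Lemma avg_swap p x y s n : ann n -> uniq (p ++ x :: y :: s) ->
  {subset csupp n <= p ++ x :: y :: s} ->
  avg (p ++ y :: x :: s) n = avg (p ++ x :: y :: s) n.
Proof.
move=> Nn uL nL; set L := p ++ x :: y :: s; set L' := p ++ y :: x :: s.
have pL : perm_eq L' L by rewrite perm_cat2l (permEl (perm_catCA [:: y] [:: x] s)).
have szL : size L' = size L := perm_size pL.
have uL' : uniq L' by rewrite (perm_uniq pL).
rewrite /avg szL.
have -> : ilim lim (size L) (fun ys => eval (place L' ys) n) =
          ilim lim (size L) ((fun ys => eval (place L ys) n) \o swap_at (size p)).
  apply: (ilim_eq limD lim_cst (D := [::])) => ys sz /andP[uys _] /=.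
  have [fX XL'] := placeP uL' uys (etrans szL (esym sz)).
  by apply: eval_place => //; rewrite -{2}XL' swap_at_map swap_at_cat.
have [c cL] := fresh_point Omega_infinite L.
have cn : c \notin csupp n by apply: contra cL; apply: nL.
have xyc : uniq [:: x; y; c].
  move: uL cL; rewrite /L cat_uniq mem_cat /= !inE !negb_or.
  move=> /and3P[_ _ /andP[/andP[-> _] _]] /and4P[_ cx cy _].
  by rewrite !(eq_sym _ c) cx cy.
apply: (ilim_swap limD lim_cst (D := [::])); last by rewrite size_cat /= !addnS !ltnS leq_addr.
move=> q y1 y2 y3 r szq sz /andP[uq _].
have szr : size r = size s.
  by move: sz; rewrite size_cat szq /= !addnS => -[] /addnI.
pose L3 := p ++ [:: x; y; c] ++ s.
have pL3 : perm_eq L3 (c :: L).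
  rewrite perm_sym; apply: (perm_trans (permEl (perm_catCA [:: c] p _))).
  rewrite perm_cat2l.
  exact: (permEl (perm_catCA [:: c] [:: x; y] s)).
have uL3 : uniq L3 by rewrite (perm_uniq pL3) /= cL.
have sz3 : size L3 = size (q ++ [:: y1; y2; y3] ++ r) by rewrite !size_cat szq szr.
have [fX] := placeP uL3 uq sz3; set Y := place L3 _ => /eqP.
rewrite !map_cat eqseq_cat ?size_map // => /andP[/eqP Yp].
rewrite eqseq_cat //= => /andP[/eqP[Yx Yy Yc] /eqP Ys].
have := trace_translate xyc Y Nn cn; rewrite trace_eq0 //.
have fx z z' u : u \in p ++ s -> z \in [:: x; y; c] -> z' \in [:: x; y; c] -> swap z z' u = u.
  move=> us zx zx'; have nu v : v \in [:: x; y; c] -> u != v.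
    move=> vx; apply/eqP => uv; move: uL3; rewrite uniq_catCA cat_uniq => /and3P[_ /hasPn nu _].
    by have /negP := nu u us; rewrite uv.
  by rewrite swapD ?nu.
have EX t i j : finitary t -> (forall u, u \in p ++ s -> t u = u) ->
    Y (t x) = i -> Y (t y) = j -> eval (t * Y)%g n = eval (place L (q ++ [:: i; j] ++ r)) n.
  move=> ft tu ti tj; apply: eval_place => //; first exact: finitaryM.
  rewrite map_cat /= ti tj -Yp -Ys; congr (_ ++ _ :: _ :: _); apply/eq_in_map => u us.
    by rewrite /= tu // mem_cat us.
  by rewrite /= tu // mem_cat us orbT.
have [xx yy cc] : [/\ x \in [:: x; y; c], y \in [:: x; y; c] & c \in [:: x; y; c]].
  by rewrite !inE !eqxx !orbT.
have [xy xc yc] : [/\ x != y, x != c & y != c].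
  by move: xyc; rewrite /= !inE negb_or => /and3P[/andP[-> ->] -> _].
have sym3f := sym3_finitary (a := x) (b := y) (c := c).
rewrite !big_cons big_nil addr0.
rewrite (EX 1%g y1 y2) //; last exact: finitary1.
rewrite (EX (swap x y) y2 y1) ?swapL ?swapR //; [|exact: finitary_swap|by move=> u us; rewrite fx].
rewrite (EX (swap y c) y1 y3) ?swapL ?swapR ?swapD //; [|exact: finitary_swap|by move=> u us; rewrite fx].
rewrite (EX (swap x y * swap y c)%g y3 y1);
  [|by apply: finitaryM; exact: finitary_swap|by move=> u us; rewrite symM !fx
   |by rewrite symM swapL swapL|by rewrite symM swapR swapD].
rewrite (EX (swap y c * swap x y)%g y2 y3);
  [|by apply: finitaryM; exact: finitary_swap|by move=> u us; rewrite symM !fx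
   |by rewrite symM (@swapD _ y c x) ?swapL|by rewrite symM swapL swapD // eq_sym].
rewrite (EX (swap x c) y3 y2);
  [|exact: finitary_swap|by move=> u us; rewrite fx|by rewrite swapL|by rewrite swapD // eq_sym].
move=> <-; rewrite !addrA; set e1 := eval _ _; set e2 := eval _ _; set e3 := eval _ _.
set e4 := eval _ _; set e5 := eval _ _; set e6 := eval _ _.
by case: (Z2P e1) => ->; case: (Z2P e2) => ->; case: (Z2P e3) => ->; case: (Z2P e4) => ->;
  case: (Z2P e5) => ->; case: (Z2P e6) => ->; apply: val_inj.
Qed.

Lemma avg_perm L L' n : ann n -> uniq L -> {subset csupp n <= L} -> perm_eq L L' ->
  avg L n = avg L' n.
Proof.
move=> Nn; have move_one p x q s : uniq (p ++ x :: q ++ s) ->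
    {subset csupp n <= p ++ x :: q ++ s} -> avg (p ++ x :: q ++ s) n = avg (p ++ q ++ x :: s) n.
  elim: q p => [//|y q IH] p uL nL.
  rewrite -[in LHS]cat_cons in uL nL *.
  rewrite -avg_swap //.
  have pE : perm_eq (p ++ x :: y :: q ++ s) ((p ++ [:: y]) ++ x :: q ++ s).
    by rewrite -catA perm_cat2l (permEl (perm_catCA [:: x] [:: y] (q ++ s))).
  have := IH (p ++ [:: y]); rewrite -!catA /=; apply.
    by rewrite -[y :: x :: _]/([:: y] ++ _) catA -(perm_uniq pE).
  by move=> z /nL; rewrite (perm_mem pE) -catA.
suff W q : uniq (q ++ L) -> {subset csupp n <= q ++ L} -> perm_eq L L' ->
    avg (q ++ L) n = avg (q ++ L') n by exact: (W [::]).
elim: L L' q => [|x L IH] L' q uL nL; first by rewrite perm_sym => /perm_nilP->.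
move=> pL; have xL' : x \in L' by rewrite -(perm_mem pL) inE eqxx.
move: pL; case/splitPr: xL' => s1 s2 pL.
have pL1 : perm_eq L (s1 ++ s2).
  rewrite -(perm_cons x); apply: (perm_trans pL).
  exact: (permEl (perm_catCA s1 [:: x] s2)).
have := IH (s1 ++ s2) (rcons q x); rewrite !cat_rcons => -> //.
have pE : perm_eq (q ++ x :: L) (q ++ x :: s1 ++ s2) by rewrite perm_cat2l perm_cons.
apply: move_one; first by rewrite -(perm_uniq pE).
by move=> z /nL; rewrite (perm_mem pE).
Qed.

(** By the cocycle law the limit at the translate of n plus the value of g at n is
    the limit for the reordered list g^-1 L, and the order does not matter. *)
Lemma avg_cocycle L g n : ann n -> uniq L -> {subset csupp n <= L} -> finitary g ->
  (forall x, g x != x -> x \in L) -> avg L n + avg L (map (kset_im g) n) = eval g n.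
Proof.
move=> Nn uL nL fg gL.
have gVL x : ((g^-1)%g x \in L) = (x \in L).
  case: (eqVneq (g x) x) => [{1}<-|gx]; first by rewrite symVK.
  rewrite (gL x gx) gL // symKV; apply: contraNneq gx => xE.
  by rewrite {1}xE symKV.
pose L' := map (g^-1)%g L.
have uL' : uniq L' by rewrite map_inj_uniq //; apply: sym_inj.
have pL' : perm_eq L L'.
  apply: uniq_perm => // x; apply/idP/mapP => [xL|[y yL ->]]; last by rewrite gVL.
  by exists (g x); rewrite ?symVK // -gVL symVK.
rewrite (avg_perm Nn uL nL pL').
have gnL : {subset csupp (map (kset_im g) n) <= L}.
  by move=> x /csupp_map /nL; rewrite gVL.
apply/eqP; rewrite -Z2_add_eq0 -addrA; apply/eqP.
have -> : avg L (map (kset_im g) n) + eval g n = avg L' n; last exact: Z2_addxx.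
have -> : avg L' n = ilim lim (size L) (fun ys => eval (place L' ys) n) by rewrite /avg size_map.
rewrite /avg.
have -> : eval g n = ilim lim (size L) (fun=> eval g n).
  by symmetry; apply: (ilim_cst limD lim_cst (D := [::])).
rewrite -ilimD //; apply: (ilim_eq limD lim_cst (D := [::])) => ys sz /andP[uys _].
have [fX XL] := placeP uL uys (esym sz).
rewrite addrC -eval_mul //; apply: eval_place => //.
- by move=> x /nL; rewrite (perm_mem pL').
- exact: finitaryM.
by rewrite -[RHS]XL /L' -map_comp; apply: eq_map => x; rewrite /= sym_invK.
Qed.

End Cohomology.

(** * Closed modules and the vanishing of first cohomology *)

Section ClosedModules.
Variables (Omega : choiceType) (l : nat).
Implicit Types (g h : SymGroup Omega) (w : kset Omega l) (F : kset Omega l -> 'Z_2).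

(** Closed submodules of the product of copies of Z_2 over the l-subsets: a
    function belongs to M as soon as M contains functions agreeing with it on the
    subsets of any given finite set. *)
Record closed_module (M : (kset Omega l -> 'Z_2) -> Prop) : Prop := {
  module0 : M (fun=> 0);
  moduleD : forall m m', M m -> M m' -> M (fun w => m w + m' w);
  moduleG : forall g m, M m -> M (fun w => m (kset_im g w));
  module_closed : forall m, (forall Z : {fset Omega}, exists2 m', M m' &
    forall w, (val w `<=` Z)%fset -> m' w = m w) -> M m }.

Lemma ksets_in (Z : {fset Omega}) :
  exists s : seq (kset Omega l), forall w, (w \in s) = (val w `<=` Z)%fset.
Proof.
exists (pmap insub (enum_fset (fpowerset Z))) => w.
by rewrite mem_pmap_sub fpowersetE.
Qed.

Variable M : (kset Omega l -> 'Z_2) -> Prop.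
Hypothesis Mmod : closed_module M.

(** Closedness reduces membership to finitely many coordinates, where the double
    annihilator is elementary. *)
Lemma bipolar F : (forall n, ann M n -> ev F n = 0) -> M F.
Proof.
move=> annF; apply: (module_closed Mmod) => Z; have [s sP] := ksets_in Z.
apply: contrapT => nex.
have [||| n [ns Mn Fn]] := separating_chain (V := M) (s := s) (F := F).
- exact: moduleD.
- exact: module0.
- move=> m Mm; apply: contrapT => nx; apply: nex; exists m => // w wZ.
  by apply/eqP; apply: contrapT => /negP mF; apply: nx; exists w; rewrite ?sP.
by have := annF n Mn; rewrite /ev Fn.
Qed.

Lemma superset_filter :
  ProperFilter [set A : set {fset Omega} | exists D, forall Z, (D `<=` Z)%fset -> A Z].
Proof.
split; first by move=> [D DA]; apply: (DA D); apply: fsubset_refl.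
split; first by exists fset0.
- move=> A B [D DA] [D' DB]; exists (D `|` D')%fset => Z.
  by rewrite fsubUset => /andP[DZ D'Z]; split; [apply: DA|apply: DB].
- by move=> A B AB [D DA]; exists D => Z /DA/AB.
Qed.

Hypothesis Omega_infinite : infinite_set [set: Omega].

Lemma cofinite_filter :
  ProperFilter [set A : set Omega | exists D : seq Omega, forall y, y \notin D -> A y].
Proof.
split.
  by move=> [D DA]; have [y /DA] := fresh_point Omega_infinite D.
split; first by exists [::].
- move=> A B [D DA] [D' DB]; exists (D ++ D') => y.
  by rewrite mem_cat negb_or => /andP[yD yD']; split; [apply: DA|apply: DB].
- by move=> A B AB [D DA]; exists D => y /DA/AB.
Qed.

(** For each finite set Z the limits avg_fun over the points of Z form a function
    whose coboundary is f on annihilating chains supported in Z.  A limit over all Z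
    glues these functions together; the resulting k satisfies the identity on every
    annihilating chain, hence modulo M. *)
Lemma cocycle_trivial (f : SymGroup Omega -> kset Omega l -> 'Z_2) :
    (forall n, ann M n -> forall a b, a != b ->
       ~~ odd (count (fun w => (a \in val w) && (b \in val w)) n)) ->
    (forall g h, M (fun w => f g w + f h (kset_im g w) + f (g * h)%g w)) ->
  exists k : kset Omega l -> 'Z_2,
    forall g, finitary g -> M (fun w => f g w + k w + k (kset_im g w)).
Proof.
move=> even fM.
have [lim [limD limF]] := filter_limit cofinite_filter.
have lim_cst (D : seq Omega) (u : Omega -> 'Z_2) c :
    (forall y, y \notin D -> u y = c) -> lim u = c.
  by move=> uc; apply: limF; exists D.
have [flim [flimD flimF]] := filter_limit superset_filter.
have flim_cst D (u : {fset Omega} -> 'Z_2) c :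
    (forall Z, (D `<=` Z)%fset -> u Z = c) -> flim u = c.
  by move=> uc; apply: flimF; exists D.
have [X XP] := permutation_choice Omega.
pose kZ (Z : {fset Omega}) := avg_fun f lim X (enum_fset Z).
pose k w := flim (fun Z => kZ Z w).
have ev_k n : ev k n = flim (fun Z => ev (kZ Z) n).
  rewrite /ev; elim: n => [|w n IH].
    by rewrite big_nil; symmetry; apply: (flim_cst fset0) => Z _; rewrite big_nil.
  by rewrite big_cons IH /k -flimD; congr flim; apply/funext => Z; rewrite big_cons.
exists k => g fg; apply: bipolar => n Nn.
rewrite !evD -ev_map !ev_k -addrA -flimD.
have [S gS] := fg.
(* A set Z containing all points moved by g is g-stable. *)
rewrite (flim_cst ([fset x in csupp n ++ S]%fset) _ (ev (f g) n)) ?Z2_addxx //.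
move=> Z /fsubsetP DZ; rewrite !ev_avg_fun //.
apply: (avg_cocycle Omega_infinite (moduleG Mmod) even fM limD lim_cst XP) => //.
- by move=> x xn; apply: DZ; rewrite in_fset /= mem_cat xn.
- move=> x gx; apply: DZ; rewrite in_fset /= mem_cat orbC; apply/orP; left.
  by apply: contraNT gx => /gS->.
Qed.

End ClosedModules.

(** * The regular representation of Z_4 *)

Lemma Z4_shiftE a x : Z4_shift a x = a + x.
Proof. by rewrite permE. Qed.

Lemma Z4_shiftX a i : (Z4_shift a ^+ i)%g = Z4_shift (a *+ i).
Proof.
elim: i => [|i IH]; apply/permP => x; first by rewrite expg0 perm1 Z4_shiftE mulr0n add0r.
by rewrite expgS permM IH !Z4_shiftE mulrS addrCA addrA.
Qed.

Lemma Z4_shift_inj : injective Z4_shift.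
Proof. by move=> a a' /permP/(_ 0); rewrite !Z4_shiftE !addr0. Qed.

Lemma Z4_nat (a : 'Z_4) : a = 1 *+ (val a).
Proof. by case: a => [[|[|[|[|n]]]] h] //; apply: val_inj. Qed.

Lemma mem_Z4_reg p : p \in Z4_reg -> exists a, p = Z4_shift a.
Proof. by move=> /cycleP[i ->]; exists (1 *+ i); rewrite Z4_shiftX. Qed.

Lemma Z4_shift_reg a : Z4_shift a \in Z4_reg.
Proof. by apply/cycleP; exists (val a); rewrite Z4_shiftX -Z4_nat. Qed.

Lemma mem_Z2_in_Z4 a : (Z4_shift a \in Z2_in_Z4) = (par a == 0).
Proof.
apply/cycleP/eqP => [[i]|pa].
  rewrite Z4_shiftX => /Z4_shift_inj ->; rewrite raddfMn.
  by rewrite Z2_mulrn; case: odd => //; apply: val_inj.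
exists (nat_of_ord (half4 a)); rewrite Z4_shiftX; congr Z4_shift.
rewrite -{1}(dbl_half pa); case: (half4 a) => [[|[|n]] h] //; exact: val_inj.
Qed.

Lemma Z2_sub_Z4 p : p \in Z2_in_Z4 -> exists a, p = Z4_shift (dbl a).
Proof.
move=> /cycleP[i ->]; rewrite Z4_shiftX; exists (1 *+ i); rewrite raddfMn.
by congr (Z4_shift (_ *+ _)); apply: val_inj.
Qed.

Lemma coset_Z4_shift a e : (coset Z2_in_Z4 (Z4_shift 1%R) ^+ nat_of_bool e)%g =
  coset Z2_in_Z4 (Z4_shift a) -> par a = e%:R.
Proof.
have shiftN b : Z4_shift b \in 'N(Z2_in_Z4)%g.
  suff /fintype.subsetP sN : (Z4_reg \subset 'N(Z2_in_Z4))%g by apply/sN/Z4_shift_reg.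
  apply: sub_abelian_norm; first exact: cycle_abelian.
  by rewrite cycle_subG; apply: Z4_shift_reg.
have cosetE b : (coset Z2_in_Z4 (Z4_shift b) == 1%g) = (par b == 0).
  by rewrite -mem_Z2_in_Z4; apply/eqP/idP => [/coset_idr->|/coset_id->].
case: e => /=.
  rewrite expg1 => E; case: (Z2P (par a)) => // pa.
  by have := cosetE 1; rewrite E; have /eqP-> : coset Z2_in_Z4 (Z4_shift a) == 1%g;
    rewrite ?cosetE ?pa ?eqxx.
by rewrite expg0 => /esym/eqP; rewrite cosetE => /eqP.
Qed.

(** * Coordinates on a sign cover *)

Section Actions.
Variables (Omega : choiceType) (k : nat) (C : Type).
Variable b : kset Omega k -> 'Z_4 -> C.
Implicit Types (g : SymGroup Omega) (w : kset Omega k) (h : SymGroup C).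

(** The fibre over w is identified with Z_4 by b w; then h over g acts on it as the
    translation by phi w onto the fibre over the image of w. *)
Definition acts_as h g (phi : kset Omega k -> 'Z_4) :=
  forall w x, h (b w x) = b (kset_im g w) (x + phi w).

Lemma acts_asM h g phi h' g' phi' : acts_as h g phi -> acts_as h' g' phi' ->
  acts_as (h * h')%g (g * g')%g (fun w => phi w + phi' (kset_im g w)).
Proof. by move=> H H' w x; rewrite symM H H' kset_imM addrA. Qed.

Lemma acts_asV h g phi : acts_as h g phi ->
  acts_as h^-1%g g^-1%g (fun w => - phi (kset_im g^-1%g w)).
Proof.
move=> H w x; set w' := kset_im g^-1%g w.
have -> : b w x = h (b w' (x - phi w')) by rewrite H kset_imKV addrNK.
by rewrite symVK.
Qed.

Lemma acts_as1 : acts_as 1%g 1%g (fun=> 0).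
Proof. by move=> w x; rewrite sym1E kset_im1 addr0. Qed.

End Actions.

(** The elements of Gamma are exactly the pairs (g, phi) with phi = psi g modulo 2,
    where psi is a cocycle that extends the sign characters of the stabilizers. *)
Record coords (Omega : choiceType) (k : nat) (C : Type) (pi : C -> kset Omega k)
    (Gamma : set (SymGroup C)) (b : kset Omega k -> 'Z_4 -> C)
    (psi : SymGroup Omega -> kset Omega k -> 'Z_2) : Prop := {
  co_pi : forall w x, pi (b w x) = w;
  co_inj : forall w, injective (b w);
  co_surj : forall c, exists x, b (pi c) x = c;
  co_lift : forall h, Gamma h -> exists g phi, acts_as b h g phi;
  co_par : forall h g phi, Gamma h -> acts_as b h g phi -> forall w, par (phi w) = psi g w;
  co_mem : forall h g phi, acts_as b h g phi -> (forall w, par (phi w) = psi g w) -> Gamma h;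
  co_ex : forall g, exists h phi, Gamma h /\ acts_as b h g phi;
  co_sign : forall g w, kset_im g w = w -> psi g w = (sign_on w g)%:R;
  co_kernel : forall f h, kernel_elt pi Gamma f h <-> acts_as b h 1%g (fun w => dbl (f w)) }.

Lemma kset_imV_eq (Omega : choiceType) k g (w w' : kset Omega k) :
  kset_im g w = w' -> kset_im g^-1%g w' = w.
Proof. by move=> <-; apply: kset_imVK. Qed.

(** If g x and g' x differed, then some k-subset of Z would contain x but not the
    point y with g y = g' x, and its two images would differ at g' x.  A k-subset
    with this property exists because Z has more than k points. *)
Lemma kset_im_faithful_on (Omega : choiceType) k (Z : {fset Omega}) (g g' : SymGroup Omega) :
  (0 < k < #|` Z|)%N ->
  (forall w : kset Omega k, (val w `<=` Z)%fset -> kset_im g w = kset_im g' w) ->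
  forall x, x \in Z -> g x = g' x.
Proof.
move=> /andP[k0 kZ] gg' x xZ; apply/eqP; apply: contrapT => /negP gx.
pose y := (g^-1)%g (g' x).
have yE : g y = g' x by rewrite symKV.
have xy : y != x by apply: contraNneq gx => yx; rewrite -yE yx.
pose ys := take k.-1 (enum_fset (Z `\ x `\ y)%fset).
have ysP z : z \in ys -> [/\ z != x, z != y & z \in Z].
  by move=> /mem_take; rewrite !inE => /and3P[].
have sz : size ys = k.-1.
  rewrite size_takel //; have := cardfsD1 x Z; have := cardfsD1 y (Z `\ x)%fset.
  move: kZ; rewrite xZ; case: (y \in _) => /=; rewrite ?add0n ?add1n => kZ e1 e2;
    by move: kZ; rewrite e2 e1; case: (k) => //= k' /ltnW.
pose A := [fset z in x :: ys]%fset.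
have Ak : #|` A| == k.
  rewrite card_fseq undup_id /=; first by rewrite sz prednK.
  rewrite take_uniq ?fset_uniq // andbT; apply/negP => /ysP[].
  by rewrite eqxx.
have AZ : (A `<=` Z)%fset.
  by apply/fsubsetP => z; rewrite !inE => /predU1P[->//|/ysP[]].
have /(congr1 val)/fsetP/(_ (g' x)) := gg' (exist _ A Ak) AZ.
rewrite -{1}yE !mem_kset_im !inE /= ?inE (negbTE xy) eqxx /=.
by move=> /ysP[]; rewrite eqxx.
Qed.

Lemma fset_enlarge (Omega : choiceType) (Z : {fset Omega}) m : infinite_set [set: Omega] ->
  exists2 Z', (Z `<=` Z')%fset & (m < #|` Z'|)%N.
Proof.
move=> inf; have [ys sz /andP[uys _]] := fresh_points inf m.+1 [::].
exists (Z `|` [fset x in ys])%fset; first exact: fsubsetUl.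
apply: leq_trans (fsubset_leq_card (fsubsetUr _ _)).
by rewrite card_fseq undup_id // sz.
Qed.

Lemma kset_im_faithful (Omega : choiceType) k (g g' : SymGroup Omega) :
  infinite_set [set: Omega] -> (0 < k)%N ->
  (forall w : kset Omega k, kset_im g w = kset_im g' w) -> g = g'.
Proof.
move=> inf k0 gg'; apply/symP => x; have [Z xZ kZ] := fset_enlarge [fset x]%fset k inf.
apply: (kset_im_faithful_on (k := k) (Z := Z)); rewrite ?k0 //.
by move/fsubsetP: xZ; apply; rewrite inE.
Qed.

Section SignCoords.
Variables (Omega : choiceType) (k : nat) (C : Type) (pi : C -> kset Omega k).
Variable Gamma : set (SymGroup C).
Hypothesis Omega_infinite : infinite_set [set: Omega].
Hypothesis cover : is_sign_cover pi Gamma.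
Implicit Types (g : SymGroup Omega) (w : kset Omega k) (h u : SymGroup C).

Let fin := free_cover_finite cover.
Let sub := perm_structure_subgroup (cover_perm_structure fin).
Let GM := @subgroupM _ _ sub.
Let GV := @subgroupV _ _ sub.

Let over h g := induces pi h (kset_act k g).

Let overM h g h' g' : over h g -> over h' g' -> over (h * h')%g (g * g')%g.
Proof. by move=> H H' x; rewrite symM H' H /= kset_imM. Qed.

Let overV h g : over h g -> over h^-1%g g^-1%g.
Proof.
by move=> H x; rewrite -{2}[x](symKV h) H /= kset_imVK.
Qed.

Let over_ex g : exists2 h, Gamma h & over h g.
Proof.
have : mu_image pi Gamma (kset_act k g) by rewrite (cover_image fin); exists g.
by move=> [h Gh hg]; exists h.
Qed.

Let lift_ex h : Gamma h -> exists g, over h g.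
Proof.
move=> Gh.
have inv h' : Gamma h' -> exists F : kset Omega k -> kset Omega k, forall x, pi (h' x) = F (pi x).
  move=> Gh'; have /choice[s sP] := cover_surj fin.
  by exists (fun w => pi (h' (s w))) => x; apply: (cover_invariant fin).
have [F FP] := inv _ Gh; have [F' FP'] := inv _ (GV Gh).
have FK : cancel F F'.
  by move=> w; have [x <-] := cover_surj fin w; rewrite -FP -FP' symVK.
have FK' : cancel F' F.
  by move=> w; have [x <-] := cover_surj fin w; rewrite -FP' -FP symKV.
have : mu_image pi Gamma (MkSymGroup FK FK') by exists h.
by rewrite (cover_image fin) => -[g _ gE]; exists g => x; rewrite gE FP.
Qed.

Let over_stab h g w : over h g -> kset_im g w = w -> h @` fibre pi w = fibre pi w.
Proof.
move=> hg gw; apply/seteqP; split=> [_ [x xw <-]|x xw].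
  by rewrite /fibre /= hg xw.
exists ((h^-1)%g x); last by rewrite symKV.
by rewrite /fibre /= (overV hg) /= xw -{1}gw kset_imVK.
Qed.

Section Chart.
Variables (w : kset Omega k) (b : 'Z_4 -> C).
Hypothesis chart : cover_chart pi Gamma (@kset_act Omega k) Z4_reg (sign_chi w) w b.

Lemma chart_fibre x : pi (b x) = w.
Proof. by have [+ _ _] := chart_bij chart; apply. Qed.

Lemma chart_inj : injective b.
Proof. by have [_ + _] := chart_bij chart => i x y; apply: i; rewrite inE. Qed.

Lemma chart_surj c : pi c = w -> exists x, b x = c.
Proof. by have [_ _ +] := chart_bij chart => s /s[x _ <-]; exists x. Qed.

Let perm_of h g : Gamma h -> over h g -> kset_im g w = w ->
  exists p : {perm 'Z_4}, forall x, h (b x) = b (p x).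
Proof.
move=> Gh hg gw.
have ex x : exists y, b y = h (b x) by apply: chart_surj; rewrite hg chart_fibre.
have [F FP] := choice ex.
have Finj : injective F by move=> x y /(congr1 b); rewrite !FP => /(@sym_inj _ h)/chart_inj.
by exists (perm Finj) => x; rewrite permE FP.
Qed.

(** In a chart an element stabilizing the fibre is a translation, whose parity the
    canonical homomorphism prescribes. *)
Lemma chart_shift h g : Gamma h -> over h g -> kset_im g w = w ->
  exists s, (forall x, h (b x) = b (x + s)) /\ par s = (sign_on w g)%:R.
Proof.
move=> Gh hg gw; have [p hp] := perm_of Gh hg gw.
have : induced_group b (fibre_stab pi Gamma w) p.
  by exists h => //; split=> //; apply: over_stab hg gw.
rewrite (chart_fibre_group chart) => /mem_Z4_reg[s sE].
exists s; split=> [x|]; first by rewrite hp sE Z4_shiftE addrC.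
apply: coset_Z4_shift; rewrite -sE; apply: (chart_canonical chart (h := h)) => //.
Qed.

Lemma chart_ker h : mu_ker pi Gamma h -> exists e, forall x, h (b x) = b (x + dbl e).
Proof.
move=> [Gh h1]; have h1' : over h 1%g by move=> x; rewrite h1 /= kset_im1.
have [p hp] := perm_of Gh h1' (kset_im1 w).
have : induced_group b (mu_ker pi Gamma) p by exists h.
rewrite (chart_binding_group chart) => /Z2_sub_Z4[e pE].
by exists e => x; rewrite hp pE Z4_shiftE addrC.
Qed.

Lemma chart_ker_ex : exists2 h, mu_ker pi Gamma h & forall x, h (b x) = b (x + dbl 1).
Proof.
have : [set` Z2_in_Z4] (Z4_shift (dbl 1)) by rewrite /= mem_Z2_in_Z4 par_dbl.
rewrite -(chart_binding_group chart) => -[h hk hE]; exists h => // x.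
by rewrite hE Z4_shiftE addrC.
Qed.

End Chart.

Let w0_ex : exists w0 : kset Omega k, True.
Proof.
have [ys sz /andP[uys _]] := fresh_points Omega_infinite k [::].
pose A := [fset z in ys]%fset.
have Ak : #|` A| == k by rewrite card_fseq undup_id // sz.
by exists (exist _ A Ak).
Qed.

(** Choosing charts independently could reverse the orientation of some fibres,
    so a single chart b0 over w0 is transported to all other fibres by elements of
    Gamma.  Arbitrary charts reappear in the sign condition and in kernel_elt; the
    coordinates in two charts of the same fibre are compared through the
    translations that are trivial or of order two, which do not depend on the
    chart. *)
Lemma coords_exist : exists b psi, coords pi Gamma b psi.
Proof.
have [w0 _] := w0_ex; have [b0 ch0] := free_cover_chart cover w0.
have [gw gwE] := choice (kset_transitive w0).
have /choice[hw hwP] w : exists h, Gamma h /\ over h (gw w).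
  by have [h] := over_ex (gw w); exists h.
pose b w x := hw w (b0 x).
have b_pi w x : pi (b w x) = w.
  by rewrite /b (proj2 (hwP w)) (chart_fibre ch0) /= gwE.
have b_inj w : injective (b w) by move=> x y /(@sym_inj _ (hw w))/(chart_inj ch0).
have b_surj c : exists x, b (pi c) x = c.
  have [|x xE] := chart_surj ch0 (c := ((hw (pi c))^-1)%g c).
    by rewrite (overV (proj2 (hwP _))); apply: kset_imV_eq.
  by exists x; rewrite /b xE symKV.
have acts h g : Gamma h -> over h g -> exists phi, acts_as b h g phi.
  move=> Gh hg.
  have ex w : exists s, forall x, h (b w x) = b (kset_im g w) (x + s).
    (* Transported to the fibre over w0, h becomes an element of its stabilizer. *)
    pose u := (hw w * h * (hw (kset_im g w))^-1)%g.
    have Gu : Gamma u by do ?apply: GM; try apply: GV; [exact: (hwP w).1| |exact: (hwP _).1].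
    have ug : over u (gw w * g * (gw (kset_im g w))^-1)%g.
      by apply: overM; [apply: overM => //; exact: (hwP w).2|apply: overV; exact: (hwP _).2].
    have [|s [sE _]] := chart_shift ch0 Gu ug.
      by rewrite !kset_imM gwE; apply: kset_imV_eq.
    by exists s => x; rewrite /b -sE /u !symM symKV.
  by have [phi phiP] := choice ex; exists phi => w x; apply: phiP.
have acts_over h g phi : acts_as b h g phi -> over h g.
  by move=> H c; have [x <-] := b_surj c; rewrite H !b_pi.
have ker_even h phi : Gamma h -> acts_as b h 1%g phi -> forall w, par (phi w) = 0.
  move=> Gh H w; pose u := (hw w * h * (hw w)^-1)%g.
  have uk : mu_ker pi Gamma u.
    split; first by do ?apply: GM; try apply: GV; [exact: (hwP w).1| |exact: (hwP _).1].
    have o := overM (overM (hwP w).2 (acts_over _ _ _ H)) (overV (hwP w).2).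
    by move=> c; rewrite o mulg1 mulgV /= kset_im1.
  have [e eE] := chart_ker ch0 uk.
  suff -> : phi w = dbl e by rewrite par_dbl.
  apply: (addrI 0); apply: (b_inj w).
  by have := H w 0; rewrite kset_im1 => <-; rewrite /b -eE /u !symM symKV.
have /choice[ph phP] g : exists phi, exists h, Gamma h /\ acts_as b h g phi.
  by have [h Gh hg] := over_ex g; have [phi] := acts h g Gh hg; exists phi, h.
pose psi g w := par (ph g w).
have b_par h g phi : Gamma h -> acts_as b h g phi -> forall w, par (phi w) = psi g w.
  move=> Gh H w; have [h' [Gh' H']] := phP g.
  have := ker_even _ _ (GM Gh (GV Gh')); rewrite -[1%g](mulgV g).
  move=> /(_ _ (acts_asM H (acts_asV H')) w).
  rewrite kset_imVK raddfB /= => /eqP; rewrite subr_eq0 => /eqP //.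
have b_mem h g phi : acts_as b h g phi -> (forall w, par (phi w) = psi g w) -> Gamma h.
  move=> H Hp; have [h' [Gh' H']] := phP g.
  have U := acts_asM H (acts_asV H'); set u := (h * h'^-1)%g in U.
  suff uk : mu_ker pi Gamma u.
    have -> : h = (u * h')%g by rewrite /u mulgKV.
    by apply: GM => //; case: uk.
  rewrite (free_cover_kernel cover) => w.
  have ue : exists e, forall x, u (b w x) = b w (x + dbl e).
    exists (half4 (phi w - ph g w)) => x.
    have p0 : par (phi w - ph g w) = 0 by rewrite raddfB /= Hp subrr.
    by rewrite (dbl_half p0) U mulgV kset_im1 kset_imVK.
  have [e eE] := ue; case: (Z2P e) => e01; subst e.
    exists 1%g; first by split; [exact: (subgroup1 sub)|].
    move=> c cw; have [x xE] := b_surj c; rewrite cw in xE.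
    by rewrite -xE eE raddf0 addr0.
  have [k0 [Gk0 k01] k0E] := chart_ker_ex ch0.
  exists ((hw w)^-1 * k0 * hw w)%g.
    split; first by do ?apply: GM => //; try apply: GV; exact: (hwP w).1.
    have k01' : over k0 1%g by move=> x; rewrite k01 /= kset_im1.
    have o := overM (overM (overV (hwP w).2) k01') (hwP w).2.
    by move=> c; rewrite o mulg1 mulVg /= kset_im1.
  move=> c cw; have [x xE] := b_surj c; rewrite cw in xE.
  by rewrite -xE eE /b !symM symVK k0E.
(* Being trivial on a fibre does not depend on the chart; applied to h and to h * h
   this compares the translations in two charts up to sign. *)
have compare w b' s s' h : cover_chart pi Gamma (@kset_act Omega k) Z4_reg (sign_chi w) w b' ->
    (forall x, h (b w x) = b w (x + s)) -> (forall x, h (b' x) = b' (x + s')) ->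
    (s == 0) = (s' == 0).
  move=> ch hs hs'; apply/eqP/eqP => s0.
    have [x xE] := b_surj (b' 0); rewrite (chart_fibre ch) in xE.
    apply: (addrI 0); apply: (chart_inj ch); rewrite -hs' -xE hs s0 addr0 addr0.
    by rewrite xE.
  have [x xE] := chart_surj ch (b_pi w 0).
  by apply: (addrI 0); apply: (b_inj w); rewrite -hs -xE hs' s0 !addr0 xE.
have twice (B : 'Z_4 -> C) s h : (forall x, h (B x) = B (x + s)) ->
    forall x, (h * h)%g (B x) = B (x + (s + s)).
  by move=> H x; rewrite symM !H addrA.
have par0 (s : 'Z_4) : (s + s == 0) = (par s == 0).
  by rewrite -dbl_par -(inj_eq dbl_inj) raddf0.
have b_sign g w : kset_im g w = w -> psi g w = (sign_on w g)%:R.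
  move=> gwE'; have [h [Gh H]] := phP g; have [b' ch] := free_cover_chart cover w.
  have [s [sE <-]] := chart_shift ch Gh (acts_over _ _ _ H) gwE'.
  have H' x : h (b w x) = b w (x + ph g w) by rewrite H gwE'.
  have := compare w b' _ _ _ ch (twice _ _ _ H') (twice _ _ _ sE).
  rewrite !par0 /psi; case: (Z2P (par s)) => ->; case: (Z2P (par (ph g w))) => -> //=.
have psi1 w : psi 1%g w = 0 by rewrite -(b_par _ _ _ (subgroup1 sub) (acts_as1 b)) raddf0.
have b_ker f h : kernel_elt pi Gamma f h <-> acts_as b h 1%g (fun w => dbl (f w)).
  split=> [[[Gh h1] hf] w x|H].
    have h1' : over h 1%g by move=> c; rewrite h1 /= kset_im1.
    have [phi H] := acts _ _ Gh h1'; rewrite H; congr (b _ (_ + _)).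
    have [b' ch] := free_cover_chart cover w.
    have H' y : h (b w y) = b w (y + phi w) by rewrite H kset_im1.
    have hs' y : h (b' y) = b' (y + dbl (f w)).
      rewrite (hf w b' ch) Z4_shiftX Z4_shiftE addrC; congr (b' (_ + _)).
      by case: (f w) => [[|[|n]] ?] //; apply: val_inj.
    have := compare _ _ _ _ _ ch H' hs'.
    rewrite -(dbl_half (ker_even _ _ Gh H w)).
    move: (half4 (phi w)) => e; rewrite -[0](raddf0 dbl) !(inj_eq dbl_inj).
    by case: (Z2P e) => ->; case: (Z2P (f w)) => ->.
  have Gh : Gamma h by apply: (b_mem _ _ _ H) => w; rewrite par_dbl psi1.
  split.
    by split=> // c; rewrite (acts_over _ _ _ H) /= kset_im1.
  move=> w b' ch x.
  have [s [sE _]] := chart_shift ch Gh (acts_over _ _ _ H) (kset_im1 w).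
  have H' y : h (b w y) = b w (y + dbl (f w)) by rewrite H kset_im1.
  have c1 := compare _ _ _ _ _ ch H' sE.
  have := compare _ _ _ _ _ ch (twice _ _ _ H') (twice _ _ _ sE).
  rewrite !par0 par_dbl eqxx => /esym/eqP s2.
  rewrite sE Z4_shiftX Z4_shiftE addrC; congr (b' (_ + _)).
  move: c1; rewrite -(dbl_half s2) -[0](raddf0 dbl) !(inj_eq dbl_inj).
  by case: (Z2P (half4 s)) => ->; case: (Z2P (f w)) => -> // _; apply: val_inj.
exists b, psi; split=> //.
- by move=> h Gh; have [g hg] := lift_ex Gh; have [phi H] := acts _ _ Gh hg; exists g, phi.
- by move=> g; have [h] := phP g; exists h, (ph g).
Qed.

End SignCoords.

(** * The topology of a symmetric group *)

Section SymTopology.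
Variable C : Type.
Implicit Types (h s : SymGroup C) (A : set C).

Definition agree A h s := forall a, A a -> s a = h a.

Lemma sym_nbhsP h (U : set (SymGroup C)) :
  nbhs h U <-> exists2 A, finite_set A & forall s, agree A h s -> U s.
Proof.
split.
  rewrite nbhsE => -[B [[D sD BE] Bh] BU].
  move: Bh; rewrite -BE => -[[f A] DA] [u uA /= uh].
  exists A; first exact: (sD _ DA).
  move=> s sh; apply: BU; rewrite -BE; exists (f, A) => //.
  exists (s * f^-1)%g; last by rewrite -mulgA mulVg mulg1.
  move=> a Aa; rewrite symM (sh a Aa) -uh symM (uA a Aa); exact: symVK.
move=> [A fA AU]; rewrite nbhsE; exists (agree A h); last by move=> s /AU.
split=> //; exists [set (h, A)]; first by move=> _ ->.
rewrite bigcup_set1; apply/seteqP; split=> [_ [u uA <-] a Aa|s sh].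
  by rewrite symM uA.
exists (s * h^-1)%g; last by rewrite -mulgA mulVg mulg1.
by move=> a Aa; rewrite symM (sh a Aa) symVK.
Qed.

Lemma sym_closedP (S : set (SymGroup C)) : closed S <->
  forall h, (forall A, finite_set A -> exists2 s, S s & agree A h s) -> S h.
Proof.
split=> [cS h hS|cS h hcl].
  apply: cS => U /sym_nbhsP[A fA AU]; have [s Ss sh] := hS A fA.
  by exists s; split=> //; apply: AU.
apply: cS => A fA; have [|s [Ss sh]] := hcl (agree A h); last by exists s.
by apply/sym_nbhsP; exists A.
Qed.

End SymTopology.

Lemma finite_shadow (Omega : choiceType) k (C : Type) (pi : C -> kset Omega k) (A : set C) :
  finite_set A -> exists Z : {fset Omega}, forall c, A c -> (val (pi c) `<=` Z)%fset.
Proof.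
move=> /(finite_image pi)/finite_seqP[s sE].
exists [fset x in csupp s]%fset => c Ac; apply/fsubsetP => x xc; rewrite in_fset /=.
apply: csuppP xc; have : [set` s] (pi c) by rewrite -sE; exists c.
by [].
Qed.

(** * Summation over pairs and the sign *)

Section PairSums.
Variable Omega : choiceType.
Implicit Types (a b : Omega) (g h : SymGroup Omega).

Section Pairs.
Variable l : nat.
Implicit Type w : kset Omega l.

Definition pairs w : {fset kset Omega 2} :=
  fset_set [set v : kset Omega 2 | (val v `<=` val w)%fset].

Lemma pairs_finite w : finite_set [set v : kset Omega 2 | (val v `<=` val w)%fset].
Proof.
have [s sP] := @ksets_in Omega 2 (val w).
by apply/finite_seqP; exists s; apply/seteqP; split=> v /=; rewrite sP.
Qed.

Lemma mem_pairs w v : (v \in enum_fset (pairs w)) = (val v `<=` val w)%fset.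
Proof.
rewrite -[LHS]/(v \in pairs w) in_fset_set; last exact: pairs_finite.
by apply/idP/idP => [/set_mem|vw]; rewrite ?inE.
Qed.

Definition asum (V : zmodType) (F : kset Omega 2 -> V) w := \sum_(v <- pairs w) F v.

Lemma alphaE f w : alpha f w = asum f w.
Proof. by rewrite /alpha /asum fsbig_finite //; apply: pairs_finite. Qed.

Lemma asumD (V : zmodType) (F G : kset Omega 2 -> V) w :
  asum (fun v => F v + G v) w = asum F w + asum G w.
Proof. exact: big_split. Qed.

Lemma asumB (V : zmodType) (F G : kset Omega 2 -> V) w :
  asum (fun v => F v - G v) w = asum F w - asum G w.
Proof. by rewrite /asum sumrB. Qed.

Lemma asum_eq (V : zmodType) (F G : kset Omega 2 -> V) w :
  (forall v, (val v `<=` val w)%fset -> F v = G v) -> asum F w = asum G w.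
Proof.
by move=> FG; apply: eq_big_seq => v; rewrite mem_pairs => /FG.
Qed.

Lemma par_asum F w : par (asum F w) = asum (fun v => par (F v)) w.
Proof. exact: raddf_sum. Qed.

Lemma dbl_asum F w : dbl (asum F w) = asum (fun v => dbl (F v)) w.
Proof. exact: raddf_sum. Qed.

Lemma kset_im_sub k g (v : kset Omega k) w :
  (val (kset_im g v) `<=` val (kset_im g w))%fset = (val v `<=` val w)%fset.
Proof.
apply/fsubsetP/fsubsetP => vw x.
  by rewrite -(mem_kset_im g v) -(mem_kset_im g w); apply: vw.
by rewrite !mem_kset_imV; apply: vw.
Qed.

Lemma pairs_im g w :
  perm_eq (enum_fset (pairs (kset_im g w))) (map (kset_im g) (enum_fset (pairs w))).
Proof.
have inj : injective (@kset_im Omega 2 g) := can_inj (@kset_imVK _ _ g).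
apply: uniq_perm; rewrite ?map_inj_uniq ?fset_uniq // => v.
rewrite -[v](kset_imKV g) (mem_map inj) !mem_pairs; exact: kset_im_sub.
Qed.

Lemma asum_im (V : zmodType) (F : kset Omega 2 -> V) g w :
  asum F (kset_im g w) = asum (fun v => F (kset_im g v)) w.
Proof. by rewrite /asum (perm_big _ (pairs_im g w)) big_map. Qed.

End Pairs.

Lemma asum_pair (V : zmodType) (F : kset Omega 2 -> V) v : asum F v = F v.
Proof.
suff pE : pairs v = [fset v]%fset by rewrite /asum pE big_seq_fset1.
apply/fsetP => u; rewrite inE -[LHS]/(u \in enum_fset (pairs v)) mem_pairs.
apply/idP/eqP => [uv|->]; last exact: fsubset_refl.
by apply/val_inj/eqP; rewrite eqEfcard uv (eqP (valP u)) (eqP (valP v)) /=.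
Qed.

Lemma sign_restr k (w : kset Omega k) g (s : {perm val w}) :
  (forall x : val w, g (val x) = val (s x)) -> sign_on w g = odd_perm s.
Proof.
move=> gs; have gw : [fset g x | x in val w]%fset = val w.
  apply/fsetP => y; apply/imfsetP/idP => /= [[x xw ->]|yw].
    by have := gs [` xw]%fset => /= ->; apply: valP.
  exists (val ((s^-1)%g [` yw]%fset)); first exact: valP.
  by rewrite gs permKV.
rewrite /sign_on; congr (odd_perm _); apply/permP => x.
by apply: val_inj; rewrite (restr_symE gw) gs.
Qed.

Lemma sign_fix k (w : kset Omega k) g :
  (forall x, x \in val w -> g x = x) -> sign_on w g = false.
Proof.
move=> gw; rewrite (@sign_restr _ _ _ 1%g) ?odd_perm1 // => x.
by rewrite perm1 gw //; apply: valP.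
Qed.

Lemma val_tperm k (w : kset Omega k) (x y z : val w) :
  swap (val x) (val y) (val z) = val (tperm x y z).
Proof.
rewrite /= /swap_fun !(inj_eq val_inj).
case: tpermP => [->|->|/eqP/negbTE-> /eqP/negbTE-> //]; rewrite eqxx //.
by case: eqP => // ->.
Qed.

Lemma sign_swap k (w : kset Omega k) a b : a != b -> a \in val w -> b \in val w ->
  sign_on w (swap a b) = true.
Proof.
move=> ab aw bw; rewrite (@sign_restr _ _ _ (tperm [` aw] [` bw])%fset).
  by rewrite odd_tperm -(inj_eq val_inj).
by move=> x; rewrite -val_tperm.
Qed.

Variable psi : SymGroup Omega -> kset Omega 2 -> 'Z_2.
Hypothesis psiM : forall g h v, psi (g * h)%g v = psi g v + psi h (kset_im g v).
Hypothesis psi_sign : forall g v, kset_im g v = v -> psi g v = (sign_on v g)%:R.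

Lemma psi_fix g v : (forall x, x \in val v -> g x = x) -> psi g v = 0.
Proof. by move=> gv; rewrite psi_sign ?kset_im_fix // sign_fix. Qed.

(** Along the transposition t of a and b, psi t v = psi t (t v) since t is an
    involution.  So the pairs containing exactly one of a, b cancel, those containing
    neither contribute 0, and {a,b} contributes its sign, 1. *)
Lemma asum_swap l (w : kset Omega l) a b : a != b -> a \in val w -> b \in val w ->
  asum (psi (swap a b)) w = 1.
Proof.
move=> ab aw bw; set t := swap a b.
have c2 : #|` [fset a; b]%fset| == 2 by rewrite cardfs2 ab.
pose v0 : kset Omega 2 := exist _ [fset a; b]%fset c2.
have v0P v : (v == v0) = (a \in val v) && (b \in val v).
  apply/eqP/andP => [->|[av bv]]; first by rewrite !inE !eqxx orbT.
  apply/val_inj/esym/eqP; rewrite eqEfcard (eqP c2) (eqP (valP v)) leqnn andbT.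
  by apply/fsubsetP => x; rewrite !inE => /orP[]/eqP->.
have v0w : v0 \in enum_fset (pairs w).
  by rewrite mem_pairs; apply/fsubsetP => x; rewrite !inE => /orP[]/eqP->.
rewrite /asum (bigD1_seq v0) ?fset_uniq //=.
have v0t : kset_im t v0 = v0 by apply: kset_im_swap; rewrite !inE !eqxx orbT.
rewrite psi_sign // sign_swap ?inE ?eqxx ?orbT //.
rewrite [X in _ + X](_ : _ = 0) ?addr0 //.
have psit v : psi t (kset_im t v) = psi t v.
  apply/eqP; rewrite -Z2_add_eq0 addrC -psiM swap2; apply/eqP.
  exact: psi_fix.
have tw : kset_im t w = w by apply: kset_im_swap; rewrite aw bw.
rewrite (bigID (fun v => a \in val v)) /=.
suff -> : \sum_(v <- pairs w | (v != v0) && (a \notin val v)) psi t v =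
          \sum_(v <- pairs w | (v != v0) && (a \in val v)) psi t v by exact: Z2_addxx.
have -> : \sum_(v <- pairs w | (v != v0) && (a \notin val v)) psi t v =
          \sum_(v <- pairs w | (a \notin val v) && (b \in val v)) psi t v.
  rewrite big_mkcond [RHS]big_mkcond; apply: eq_bigr => v _; rewrite v0P.
  case av: (a \in val v) => //=; case bv: (b \in val v) => //=.
  apply: psi_fix => x xv; apply: swapD; first by apply: contraTneq xv => ->; rewrite av.
  by apply: contraTneq xv => ->; rewrite bv.
have := pairs_im t w; rewrite tw => /(perm_big _) ->; rewrite big_map.
apply: eq_big => [v|v _]; last exact: psit.
have -> : (a \in val (kset_im t v)) = (b \in val v) by rewrite mem_kset_imV swapV swapL.
have -> : (b \in val (kset_im t v)) = (a \in val v) by rewrite mem_kset_imV swapV swapR.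
by rewrite v0P; do 2!case: (_ \in val v).
Qed.

(** Summing psi over the pairs in w gives a homomorphism on the stabilizer of w
    that depends only on the restriction to w and takes the value 1 on
    transpositions. *)
Lemma sign_sum l (w : kset Omega l) g : kset_im g w = w ->
  asum (psi g) w = (sign_on w g)%:R.
Proof.
move=> /(congr1 val) gw; rewrite /sign_on; move: (restr_symE gw); set s := restr_sym _ _.
move: s; clear gw => s gs; have [ts tsE tsd] := prod_tpermP s; subst s.
elim: ts g gs tsd => [|[x y] ts IH] g gs /=.
  rewrite big_nil odd_perm1 => _; rewrite big_nil in gs.
  apply: big1_seq => v /andP[_]; rewrite mem_pairs => /fsubsetP vw.
  by apply: psi_fix => z /vw zw; have := gs [` zw]%fset; rewrite perm1.
move=> /andP[xy tsd]; rewrite big_cons odd_mul_tperm.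
set t := swap (val x) (val y).
have -> : g = (t * (t * g))%g by rewrite mulgA swap2 mul1g.
have tw : kset_im t w = w by apply: kset_im_swap; rewrite !fsvalP.
have -> : asum (psi (t * (t * g))%g) w =
    asum (psi t) w + asum (psi (t * g)%g) w.
  rewrite -[in X in _ + X]tw asum_im -asumD; apply: asum_eq => v _; exact: psiM.
rewrite asum_swap ?fsvalP ?(inj_eq val_inj) // (IH (t * g)%g) //; last first.
  move=> z; rewrite symM val_tperm -gs big_cons permM tpermK //.
by move: xy => /= ->; case: odd_perm; apply: val_inj.
Qed.

End PairSums.

(** * Change of coordinates *)

Section Rebase.
Variables (Omega : choiceType) (k : nat) (C : Type) (pi : C -> kset Omega k).
Variables (Gamma : set (SymGroup C)) (b : kset Omega k -> 'Z_4 -> C).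
Variable psi : SymGroup Omega -> kset Omega k -> 'Z_2.
Hypothesis co : coords pi Gamma b psi.

Lemma psi_mul : is_subgroup Gamma -> forall g h w,
  psi (g * h)%g w = psi g w + psi h (kset_im g w).
Proof.
move=> sub g h w; have [u [phi [Gu U]]] := co_ex co g; have [u' [phi' [Gu' U']]] := co_ex co h.
rewrite -(co_par co (subgroupM sub Gu Gu') (acts_asM U U')) raddfD /=.
by rewrite (co_par co Gu U) (co_par co Gu' U').
Qed.

(** Translating the chart over w by t w changes psi by the coboundary of t. *)
Lemma coords_rebase (t : kset Omega k -> 'Z_2) psi' :
  (forall g w, psi' g w = psi g w + (t w + t (kset_im g w))) ->
  coords pi Gamma (fun w x => b w (x + lift01 (t w))) psi'.
Proof.
move=> psiE; set b' := fun w x => _; pose T w := lift01 (t w).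
have to h g phi : acts_as b h g phi ->
    acts_as b' h g (fun w => phi w + (T w - T (kset_im g w))).
  move=> H w x; rewrite /b' H; congr (b _ _).
  by rewrite -!addrA addNr addr0 (addrC (T w)).
have from h g phi : acts_as b' h g phi ->
    acts_as b h g (fun w => phi w - (T w - T (kset_im g w))).
  move=> H w x; rewrite -{1}[x](subrK (T w)); have := H w (x - T w); rewrite /b' => ->.
  by congr (b _ _); rewrite opprB -!addrA; congr (_ + _); rewrite addrC -addrA.
have parT g w : par (T w - T (kset_im g w)) = t w + t (kset_im g w).
  by rewrite raddfB /= !par_lift01 Z2_oppr.
split.
- by move=> w x; apply: (co_pi co).
- by move=> w x y /(co_inj co)/addIr.
- move=> c; have [x xE] := co_surj co c; exists (x - T (pi c)).
  by rewrite /b' subrK.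
- move=> h Gh; have [g [phi H]] := co_lift co Gh.
  by exists g, (fun w => phi w + (T w - T (kset_im g w))); apply: to.
- move=> h g phi Gh /from H w; rewrite psiE -(co_par co Gh H) raddfB /= parT.
  by rewrite subrK.
- move=> h g phi /from H Hp; apply: (co_mem co H) => w.
  by rewrite raddfB /= parT Hp psiE addrK.
- move=> g; have [h [phi [Gh H]]] := co_ex co g.
  by exists h, (fun w => phi w + (T w - T (kset_im g w))); split=> //; apply: to.
- by move=> g w gw; rewrite psiE gw Z2_addxx addr0; apply: (co_sign co).
move=> f h; rewrite (co_kernel co); split=> [/to|/from] H w x; rewrite H kset_im1.
  by rewrite subrr addr0.
by rewrite subrr subr0.
Qed.

End Rebase.

(** The action is transitive, so a Z_2-valued cocycle is determined up to a
    coboundary by its restriction to the stabilizer of one point. *)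
Lemma cohomologous (Omega : choiceType) k (psi psi' : SymGroup Omega -> kset Omega k -> 'Z_2) :
  (forall g h w, psi (g * h)%g w = psi g w + psi h (kset_im g w)) ->
  (forall g h w, psi' (g * h)%g w = psi' g w + psi' h (kset_im g w)) ->
  (forall g w, kset_im g w = w -> psi g w = psi' g w) ->
  exists t, forall g w, psi' g w = psi g w + (t w + t (kset_im g w)).
Proof.
move=> psiM psi'M E.
case: (pselect (exists w0 : kset Omega k, True)) => [[w0 _]|nw]; last first.
  by exists (fun=> 0) => g w; case: nw; exists w.
have [gw gwE] := choice (kset_transitive w0).
pose d g w := psi g w + psi' g w.
have dM g h w : d (g * h)%g w = d g w + d h (kset_im g w).
  by rewrite /d psiM psi'M addrACA.
have d0 g w : kset_im g w = w -> d g w = 0 by move=> gwE'; rewrite /d E // Z2_addxx.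
exists (fun w => d (gw w) w0) => g w.
suff : d (gw (kset_im g w)) w0 = d (gw w) w0 + d g w.
  by move=> ->; rewrite (addrA (d (gw w) w0)) Z2_addxx add0r addrA Z2_addxx add0r.
have -> : d (gw w) w0 + d g w = d (gw w * g)%g w0 by rewrite dM gwE.
set u := (gw w * g)%g; set u' := gw (kset_im g w).
have -> : u = (u' * (u'^-1 * u))%g by rewrite mulgA mulgV mul1g.
rewrite dM [d (u'^-1 * u)%g _]d0 ?addr0 //.
by rewrite -kset_imM mulgA mulgV mul1g kset_imM !gwE.
Qed.

(** * Full subgroups and their kernels *)

Section ActsAs.
Variables (Omega : choiceType) (k : nat) (C : Type) (pi : C -> kset Omega k).
Variables (Gamma : set (SymGroup C)) (b : kset Omega k -> 'Z_4 -> C).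
Variable psi : SymGroup Omega -> kset Omega k -> 'Z_2.
Hypothesis Omega_infinite : infinite_set [set: Omega].
Hypothesis k_gt0 : (0 < k)%N.
Hypothesis co : coords pi Gamma b psi.
Implicit Types (g : SymGroup Omega) (w : kset Omega k) (h u s : SymGroup C).

Lemma acts_as_inj h h' g phi : acts_as b h g phi -> acts_as b h' g phi -> h = h'.
Proof. by move=> H H'; apply/symP => c; have [x <-] := co_surj co c; rewrite H H'. Qed.

Lemma acts_as_ext h g phi phi' : phi =1 phi' -> acts_as b h g phi -> acts_as b h g phi'.
Proof. by move=> E H w x; rewrite H E. Qed.

Lemma acts_as_pi h g phi c : acts_as b h g phi -> pi (h c) = kset_im g (pi c).
Proof. by move=> H; have [x <-] := co_surj co c; rewrite H !(co_pi co). Qed.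

Lemma acts_as_agree h g phi h' g' phi' w x : acts_as b h g phi -> acts_as b h' g' phi' ->
  h (b w x) = h' (b w x) -> kset_im g w = kset_im g' w /\ phi w = phi' w.
Proof.
move=> H H'; rewrite H H' => E; have gw : kset_im g w = kset_im g' w.
  by have := congr1 pi E; rewrite !(co_pi co).
by split=> //; move: E; rewrite gw => /(co_inj co)/addrI.
Qed.

Lemma acts_as_uniq h g phi g' phi' : acts_as b h g phi -> acts_as b h g' phi' ->
  g = g' /\ phi =1 phi'.
Proof.
move=> H H'; have E w := acts_as_agree (x := 0) H H' (erefl (h (b w 0))).
split; last by move=> w; have [] := E w.
by apply: (kset_im_faithful Omega_infinite k_gt0) => w; have [] := E w.
Qed.

Lemma acts_as_ex g phi : exists h, acts_as b h g phi.
Proof.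
have [x xE] := choice (co_surj co).
have x_b w y : x (b w y) = y.
  by apply: (co_inj co (w := w)); have := xE (b w y); rewrite (co_pi co).
pose F g (phi : kset Omega k -> 'Z_4) c := b (kset_im g (pi c)) (x c + phi (pi c)).
have FE g' phi' w y : F g' phi' (b w y) = b (kset_im g' w) (y + phi' w).
  by rewrite /F (co_pi co) x_b.
pose phiV w := - phi (kset_im g^-1%g w).
have FK : cancel (F g phi) (F g^-1%g phiV).
  move=> c; rewrite -{1}(xE c) !FE kset_imVK /phiV kset_imVK addrK; exact: xE.
have FKV : cancel (F g^-1%g phiV) (F g phi).
  by move=> c; rewrite -{1}(xE c) !FE kset_imKV /phiV addrNK; exact: xE.
by exists (MkSymGroup FK FKV) => w y; rewrite /= FE.
Qed.

Lemma acts_as_conj h g phi u m : acts_as b h g phi -> acts_as b u 1%g (fun w => dbl (m w)) ->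
  acts_as b (h^-1 * u * h)%g 1%g (fun w => dbl (m (kset_im g^-1%g w))).
Proof.
move=> H U; have := acts_asM (acts_asM (acts_asV H) U) H.
rewrite mulg1 mulVg; apply: acts_as_ext => w.
by rewrite addrAC addNr add0r.
Qed.

Lemma fibres_finite (Z : {fset Omega}) : finite_set [set c | (val (pi c) `<=` Z)%fset].
Proof.
have [s sP] := @ksets_in Omega k Z.
have -> : [set c | (val (pi c) `<=` Z)%fset] =
    (fun p : kset Omega k * 'Z_4 => b p.1 p.2) @`
      [set` [seq (w, x) | w <- s, x <- enum 'Z_4]].
  apply/seteqP; split=> [c cZ|_ [[w x] + <-]].
    have [x xE] := co_surj co c; exists (pi c, x) => //=.
    by apply: allpairs_f; rewrite ?sP ?mem_enum.
  by move=> /= /allpairsP[[w' x'] /= [w's _ [-> _]]]; rewrite (co_pi co) -sP.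
by apply: finite_image; apply: finite_seq.
Qed.

Lemma acts_as_agree_on (Z : {fset Omega}) h g phi h' g' phi' : (k < #|` Z|)%N ->
  acts_as b h g phi -> acts_as b h' g' phi' ->
  agree [set c | (val (pi c) `<=` Z)%fset] h' h ->
  (forall x, x \in Z -> g x = g' x) /\
  (forall w, (val w `<=` Z)%fset -> phi w = phi' w).
Proof.
move=> kZ H H' hh'.
have E w : (val w `<=` Z)%fset -> kset_im g w = kset_im g' w /\ phi w = phi' w.
  move=> wZ; apply: (acts_as_agree (x := 0) H H'); apply: hh'.
  by rewrite /= (co_pi co).
split=> [x xZ|w /E[]//]; apply: (kset_im_faithful_on (k := k) (Z := Z)) => //.
  by rewrite k_gt0.
by move=> w /E[].
Qed.

Hypothesis sub : is_subgroup Gamma.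

Lemma psi1 w : psi 1%g w = 0.
Proof. by apply: (addrI (psi 1%g w)); rewrite addr0 -{2}(kset_im1 w) -(psi_mul co sub) mulg1. Qed.

Lemma psi_agree g g' w : (forall x, x \in val w -> g x = g' x) -> psi g w = psi g' w.
Proof.
move=> gg'; have -> : g' = (g * (g^-1 * g'))%g by rewrite mulgA mulgV mul1g.
rewrite (psi_mul co sub) [X in _ + X](_ : _ = 0) ?addr0 //.
have fix_gw x : x \in val (kset_im g w) -> (g^-1 * g')%g x = x.
  by rewrite mem_kset_imV symM => /gg' <-; rewrite symKV.
by rewrite (co_sign co (kset_im_fix fix_gw)) sign_fix.
Qed.

Variable Sigma : set (SymGroup C).
Hypothesis full : is_full pi (@symG Omega k) Gamma Sigma.

Lemma full_ex g : exists s phi, Sigma s /\ acts_as b s g phi.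
Proof.
have : mu_image pi Sigma (kset_act k g) by rewrite (full_image full); exists g.
move=> [s Ss sg]; have [g' [phi S]] := co_lift co (full_sub full Ss).
exists s, phi; split=> //; suff -> : g = g' by [].
apply: (kset_im_faithful Omega_infinite k_gt0) => w.
by have := sg (b w 0); rewrite (acts_as_pi _ S) !(co_pi co).
Qed.

Definition kernel_module (m : kset Omega k -> 'Z_2) :=
  exists2 s, Sigma s & acts_as b s 1%g (fun w => dbl (m w)).

Lemma kernel_module_ext m m' : m =1 m' -> kernel_module m -> kernel_module m'.
Proof. by move=> /funext->. Qed.

Lemma kernel_module_mem m u : kernel_module m -> acts_as b u 1%g (fun w => dbl (m w)) ->
  Sigma u.
Proof. by move=> [s Ss S] U; rewrite (acts_as_inj U S). Qed.

Lemma kernel_module_closed : closed_module kernel_module.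
Proof.
have sS := full_subgroup full; split.
- by exists 1%g; [exact: subgroup1|apply: acts_as_ext (acts_as1 b) => w; rewrite raddf0].
- move=> m m' [s Ss S] [s' Ss' S']; exists (s * s')%g; first exact: subgroupM.
  rewrite -[1%g]mulg1; apply: acts_as_ext (acts_asM S S') => w.
  by rewrite kset_im1 raddfD.
- move=> g m [u Su U]; have [s [phi [Ss S]]] := full_ex g^-1%g.
  exists (s^-1 * u * s)%g; first by do ?apply: subgroupM => //; apply: subgroupV.
  by apply: acts_as_ext (acts_as_conj S U) => w; rewrite invgK.
move=> m mcl; have [h H] := acts_as_ex 1%g (fun w => dbl (m w)); exists h => //.
apply: (proj1 (sym_closedP _) (full_closed full)) => A fA.
have [Z AZ] := finite_shadow pi fA; have [m' [s Ss S] m'E] := mcl Z.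
exists s => // c Ac; have [x <-] := co_surj co c.
by rewrite S H m'E //; apply: AZ.
Qed.

(** Let s in Sigma lie over the transposition t of a and b'.  The kernel element
    s * s is given by a t-invariant function m that takes the value 1 on sets
    containing a and b', and 0 on sets containing neither.  Pairing m with the second
    difference of n along the transpositions (a c) and (b' d) gives
    N + Q c + Q d = 0 for fresh c and d, where N counts the members of n containing
    a and b'.  Adding this over the three pairs of three fresh points gives N = 0. *)
Lemma kernel_module_even n a b' : ann kernel_module n -> a != b' ->
  ~~ odd (count (fun w => (a \in val w) && (b' \in val w)) n).
Proof.
move=> Nn ab; set t := swap a b'; have Mmod := kernel_module_closed.
have [s [phi [Ss S]]] := full_ex t.
have p0 w : par (phi w + phi (kset_im t w)) = 0.
  rewrite raddfD /= !(co_par co (full_sub full Ss) S) -(psi_mul co sub) swap2.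
  exact: psi1.
pose m w := half4 (phi w + phi (kset_im t w)).
have dm w : dbl (m w) = phi w + phi (kset_im t w) by apply: dbl_half.
have Mm : kernel_module m.
  exists (s * s)%g; first exact: (subgroupM (full_subgroup full)).
  by have := acts_asM S S; rewrite swap2; apply: acts_as_ext => w; rewrite dm.
have mt w : m (kset_im t w) = m w.
  by rewrite /m -kset_imM swap2 kset_im1 addrC.
have m_sign w : kset_im t w = w -> m w = (sign_on w t)%:R.
  move=> tw; apply: dbl_inj; rewrite dm tw -dbl_par (co_par co (full_sub full Ss) S).
  by rewrite (co_sign co).
have m1 w : a \in val w -> b' \in val w -> m w = 1.
  by move=> aw bw; rewrite m_sign ?sign_swap // kset_im_swap // aw bw.
have m0 w : a \notin val w -> b' \notin val w -> m w = 0.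
  move=> aw bw; rewrite m_sign; last by rewrite kset_im_swap // (negbTE aw) (negbTE bw).
  rewrite sign_fix // => x xw; apply: swapD.
    by apply: contraTneq xw => ->.
  by apply: contraTneq xw => ->.
pose P w := (a \in val w) && (b' \in val w).
pose Q c := \sum_(w <- n | P w) m (kset_im (swap b' c) w).
have key c d : c \notin csupp n -> d \notin csupp n -> uniq [:: a; b'; c; d] ->
    (count P n)%:R + Q c + Q d = 0 :> 'Z_2.
  move=> cn dn u; have c0 : ev (cross a b' c d m) n = 0.
    have Na g n' : ann kernel_module n' -> ann kernel_module (map (kset_im g) n').
      by move=> Nn'; apply: (ann_map (moduleG Mmod)).
    by rewrite ev_crossE (Nn m Mm) !(Na _ _ _ _ Mm) ?addr0 //; apply: Na.
  have [ac ad bc bd cd] : [/\ a != c, a != d, b' != c, b' != d & c != d].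
    move: u; rewrite /= !inE !negb_or.
    by move=> /and4P[/and3P[_ -> ->] /andP[-> ->] -> _].
  move: c0; rewrite ev_cross // => <-.
  rewrite /Q -sum1_count natr_sum -!big_split /= big_seq_cond [RHS]big_seq_cond.
  apply: eq_bigr => w /andP[wn /andP[aw bw]].
  have cw : c \notin val w := csuppN cn wn; have dw : d \notin val w := csuppN dn wn.
  have tw : kset_im t w = w by rewrite kset_im_swap // aw bw.
  have e1 : m (kset_im (swap a c) w) = m (kset_im (swap b' c) w).
    have ta : t a = b' by exact: swapL.
    have tc : t c = c by apply: swapD; rewrite eq_sym.
    by rewrite -mt -kset_imM (swap_conj t a c) ta tc kset_imM tw.
  have e0 : m (kset_im (swap b' d) (kset_im (swap a c) w)) = 0.
    apply: m0; rewrite !mem_kset_imV !swapV.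
      by rewrite (swapD ab ad) swapL.
    by rewrite swapL swapD // eq_sym.
  by rewrite /cross (m1 w aw bw) e1 e0 addr0.
have [[|c1 [|c2 [|c3 [|? ?]]]] //= _ fr] := fresh_points Omega_infinite 3 ([:: a; b'] ++ csupp n).
have [n1 n2 n3] : [/\ c1 \notin csupp n, c2 \notin csupp n & c3 \notin csupp n].
  move: fr => /andP[_ /and4P[]] /=; rewrite !inE !negb_or.
  by move=> /and3P[_ _ ->] /and3P[_ _ ->] /and3P[_ _ ->].
have [u12 u13 u23] : [/\ uniq [:: a; b'; c1; c2], uniq [:: a; b'; c1; c3]
    & uniq [:: a; b'; c2; c3]].
  move: fr; rewrite /fresh /= !inE !negb_or !andbT ab /=.
  move=> /andP[/andP[/andP[-> ->] ->]] /and3P[/and3P[a1 b1 _] /and3P[a2 b2 _] /and3P[a3 b3 _]].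
  by rewrite ![_ == c1]eq_sym ![_ == c2]eq_sym ![_ == c3]eq_sym a1 b1 a2 b2 a3 b3.
have := key _ _ n1 n2 u12; have := key _ _ n1 n3 u13; have := key _ _ n2 n3 u23.
rewrite -/P Z2_mulrn; case: odd => //.
by case: (Z2P (Q c1)) => ->; case: (Z2P (Q c2)) => ->; case: (Z2P (Q c3)) => ->.
Qed.

(** Pairing the sum over pairs of f with n weighs f v by the number of members of
    n that contain v, which is even. *)
Lemma alpha_kernel_module f : kernel_module (asum f).
Proof.
apply: (bipolar kernel_module_closed) => n Nn.
have [s sP] := @ksets_in Omega 2 [fset x in csupp n]%fset.
have pE w : w \in n -> asum f w =
    \sum_(v <- undup s) (if (val v `<=` val w)%fset then f v else 0).
  move=> wn; rewrite -big_mkcond -big_filter; apply: perm_big.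
  apply: uniq_perm; rewrite ?filter_uniq ?undup_uniq ?fset_uniq // => v.
  rewrite mem_pairs mem_filter mem_undup sP; case vw: (_ `<=` _)%fset => //=.
  apply/esym/fsubsetP => x xv; rewrite in_fset; apply: csuppP wn _.
  by move: vw => /fsubsetP; apply.
rewrite /ev (eq_big_seq _ pE) exchange_big /= big1 // => v _.
rewrite -big_mkcond big_const_seq iter_addr_0 Z2_mulrn.
have := card_kset v; have := fset_uniq (val v).
have vE x : x \in enum_fset (val v) = (x \in val v) by [].
move: vE; case: (enum_fset _) => [|x [|y [|? ?]]] // vE /= xy _.
rewrite inE in xy; rewrite ifN // -(eq_count (a1 := fun w => (x \in val w) && (y \in val w))).
  by apply: kernel_module_even => //; case/andP: xy.
move=> w /=; apply/andP/fsubsetP => [[xw yw] z|vw].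
  by rewrite -vE !inE => /orP[]/eqP->.
by split; apply: vw; rewrite -vE !inE eqxx ?orbT.
Qed.

End ActsAs.

(** * The homomorphism gamma and its conjugates *)

Lemma cocycle_defect (V : zmodType) (a b c s t u : V) :
  (a - s) + (b - t) - (c - u) + (s + t - u) = a + b - c.
Proof.
rewrite (addrACA a) -opprD opprB; move: (a + b) (s + t) => A S.
by rewrite -[A - S + _ + _]addrA (addrC (u - c)) [S - u + _]addrA subrK addrA subrK.
Qed.

Lemma coboundary_defect (V : zmodType) (f k k' p t : V) : f + f = 0 ->
  f + k + k' + (p - t) + (f + t) = k + p + k'.
Proof.
move=> ff; rewrite addrACA subrK [f + k + k' + f]addrC -!addrA.
by rewrite [f + (f + _)]addrA ff add0r [k' + p]addrC.
Qed.

Section Gamma.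
Variables (Omega : choiceType) (l : nat).
Hypothesis Omega_infinite : infinite_set [set: Omega].
Hypothesis l_gt0 : (0 < l)%N.
Variables (C2 : Type) (pi2 : C2 -> kset Omega 2) (Gamma2 : set (SymGroup C2)).
Variables (b2 : kset Omega 2 -> 'Z_4 -> C2) (psi2 : SymGroup Omega -> kset Omega 2 -> 'Z_2).
Hypothesis co2 : coords pi2 Gamma2 b2 psi2.
Hypothesis sub2 : is_subgroup Gamma2.
Variables (C : Type) (pi : C -> kset Omega l) (Gamma : set (SymGroup C)).
Variable b : kset Omega l -> 'Z_4 -> C.
Hypothesis co : coords pi Gamma b (fun g w => asum (psi2 g) w).
Hypothesis sub : is_subgroup Gamma.
Hypothesis Gamma_closed : closed Gamma.
Implicit Types (g : SymGroup Omega) (w : kset Omega l).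

(** In coordinates gamma sends (g, phi) to (g, asum phi); the target belongs to
    the cover on l-subsets because its charts are normalized by psi = asum psi2. *)
Lemma gamma_exists : exists gamma : SymGroup C2 -> SymGroup C,
  forall h g phi, acts_as b2 h g phi -> acts_as b (gamma h) g (asum phi).
Proof.
have /choice[gamma gP] h : exists h', forall g phi,
    acts_as b2 h g phi -> acts_as b h' g (asum phi); last by exists gamma.
case: (pselect (exists g phi, acts_as b2 h g phi)) => [[g [phi H]]|nH]; last first.
  by exists 1%g => g phi H; case: nH; exists g, phi.
have [h' H'] := acts_as_ex co g (asum phi); exists h' => g0 phi0 H0.
have [<- E] := acts_as_uniq Omega_infinite (ltn0Sn 1) co2 H H0.
by apply: acts_as_ext H' => w; apply: asum_eq => v _; apply: E.
Qed.

Variable gamma : SymGroup C2 -> SymGroup C.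
Hypothesis gammaP : forall h g phi, acts_as b2 h g phi -> acts_as b (gamma h) g (asum phi).

Lemma gamma_mem h : Gamma2 h -> Gamma (gamma h).
Proof.
move=> Gh; have [g [phi H]] := co_lift co2 Gh; apply: (co_mem co (gammaP H)) => w.
by rewrite par_asum; apply: asum_eq => v _; apply: (co_par co2 Gh H).
Qed.

Lemma gammaM h h' : Gamma2 h -> Gamma2 h' -> gamma (h * h')%g = (gamma h * gamma h')%g.
Proof.
move=> Gh Gh'; have [g [phi H]] := co_lift co2 Gh; have [g' [phi' H']] := co_lift co2 Gh'.
apply: (acts_as_inj co (gammaP (acts_asM H H'))).
apply: acts_as_ext (acts_asM (gammaP H) (gammaP H')) => w.
by rewrite asumD asum_im.
Qed.

Lemma gamma1 : gamma 1%g = 1%g.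
Proof.
have G1 := subgroup1 sub2.
by apply: (mulgI (gamma 1%g)); rewrite -gammaM // !mulg1.
Qed.

Lemma gammaV h : Gamma2 h -> gamma h^-1%g = (gamma h)^-1%g.
Proof.
move=> Gh; apply: (mulgI (gamma h)); rewrite -gammaM //; last exact: (subgroupV sub2).
by rewrite !mulgV gamma1.
Qed.

Lemma gamma_kernel f h : kernel_elt pi2 Gamma2 f h ->
  kernel_elt pi Gamma (alpha f) (gamma h).
Proof.
move=> /(co_kernel co2) H; apply/(co_kernel co); apply: acts_as_ext (gammaP H) => w.
by rewrite alphaE dbl_asum.
Qed.

Lemma gamma_continuous : {within Gamma2, continuous gamma}.
Proof.
apply/subspace_continuousP => h Gh U /sym_nbhsP[A fA AU].
have [Z0 AZ0] := finite_shadow pi fA.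
(* With more than two points in Z, the action on its pairs determines the action
   on its points. *)
have [Z Z0Z Zl] := fset_enlarge Z0 2 Omega_infinite.
apply/sym_nbhsP; exists [set c | (val (pi2 c) `<=` Z)%fset]; first exact: (fibres_finite co2).
move=> s sh Gs; apply: AU => c Ac.
have [g [phi H]] := co_lift co2 Gh; have [g' [phi' S]] := co_lift co2 Gs.
have [gg' phiE] := acts_as_agree_on (ltn0Sn 1) co2 Zl S H sh.
have cZ := fsubset_trans (AZ0 c Ac) Z0Z.
have [x <-] := co_surj co c; rewrite (gammaP H) (gammaP S).
congr (b _ (_ + _)).
  by apply: kset_im_eq => y yw; apply: gg'; move/fsubsetP: cZ; apply.
by apply: asum_eq => v vw; apply: phiE; apply: fsubset_trans vw cZ.
Qed.

(** The kernel on pairs is compact: solutions e on finite sets Z have a limit. *)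
Lemma alpha_range_closed (m : kset Omega l -> 'Z_2) (D : {fset Omega}) :
  (forall Z, (D `<=` Z)%fset -> exists e, forall w, (val w `<=` Z)%fset -> asum e w = m w) ->
  exists e, forall w, asum e w = m w.
Proof.
move=> He; have [lim [limD limF]] := filter_limit (superset_filter Omega).
have /choice[e eP] Z : exists e, (D `<=` Z)%fset ->
    forall w, (val w `<=` Z)%fset -> asum e w = m w.
  case: (boolP (D `<=` Z)%fset) => DZ; last by exists (fun=> 0).
  by have [e eE] := He Z DZ; exists e.
exists (fun v => lim (fun Z => e Z v)) => w.
have -> : asum (fun v => lim (fun Z => e Z v)) w = lim (fun Z => asum (e Z) w).
  rewrite /asum; elim: (enum_fset _) => [|v s IH].
    by rewrite big_nil; symmetry; apply: limF; exists fset0 => Z _; rewrite /= big_nil.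
  by rewrite big_cons IH -limD; congr lim; apply/funext => Z; rewrite big_cons.
apply: limF; exists (D `|` val w)%fset => Z; rewrite fsubUset => /andP[DZ wZ].
exact: eP.
Qed.

(** An element h in the closure lies over some g; dividing by a lift p0 of g leaves
    a function that agrees with some asum e on each finite set.  On a set Z
    with more than l points, agreement on the fibres forces agreement of the
    permutations of Omega; hence the local solutions e exist. *)
Lemma gamma_range_closed : closed (gamma @` Gamma2).
Proof.
apply/sym_closedP => h hcl.
have Gh : Gamma h.
  apply: (proj1 (sym_closedP _) Gamma_closed) => A /hcl[_ [s Gs <-] sh].
  by exists (gamma s) => //; apply: gamma_mem.
have [g [phi H]] := co_lift co Gh; have [p0 [phi0 [Gp0 P0]]] := co_ex co2 g.
have par_phi w : par (phi w - asum phi0 w) = 0.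
  rewrite raddfB /= (co_par co Gh H) par_asum; apply/eqP; rewrite subr_eq0; apply/eqP.
  by apply: asum_eq => v _; rewrite (co_par co2 Gp0 P0).
have [D _ Dl] := fset_enlarge fset0 l Omega_infinite.
have [|e eE] := @alpha_range_closed (fun w => half4 (phi w - asum phi0 w)) D.
  move=> Z DZ.
  have Zl : (l < #|` Z|)%N by apply: leq_trans Dl (fsubset_leq_card DZ).
  have [_ [q Gq <-] qh] := hcl _ (fibres_finite co Z).
  have [gq [phiq Q]] := co_lift co2 Gq.
  have [gg phiE] := acts_as_agree_on l_gt0 co Zl (gammaP Q) H qh.
  exists (fun v => half4 (phiq v - phi0 v)) => w wZ; apply: dbl_inj.
  rewrite dbl_half // -(phiE w wZ) dbl_asum -asumB; apply: asum_eq => v vw.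
  rewrite dbl_half // raddfB /= (co_par co2 Gq Q) (co_par co2 Gp0 P0).
  rewrite (psi_agree co2 sub2 (g' := g)) ?subrr // => x xv.
  by apply: gg; move/fsubsetP: wZ; apply; move/fsubsetP: vw; apply.
have [p P] := acts_as_ex co2 g (fun v => phi0 v + dbl (e v)).
exists p.
  by apply: (co_mem co2 P) => v; rewrite raddfD /= par_dbl addr0 (co_par co2 Gp0 P0).
apply: (acts_as_inj co (gammaP P)); apply: acts_as_ext H => w.
by rewrite asumD -dbl_asum eE dbl_half // addrC subrK.
Qed.

Let conj_range h := image_conj (gamma @` Gamma2) h.

Lemma conj_range_full h : Gamma h -> is_full pi (@symG Omega l) Gamma (conj_range h).
Proof.
move=> Gh; have subT : conj_range h `<=` Gamma.
  move=> _ [_ [q Gq <-] <-]; do ?apply: (subgroupM sub) => //; first exact: (subgroupV sub).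
  exact: gamma_mem.
split=> //.
- split.
  + exists 1%g; last by rewrite mulg1 mulVg.
    by exists 1%g; [exact: (subgroup1 sub2)|exact: gamma1].
  + move=> _ _ [_ [q Gq <-] <-] [_ [q' Gq' <-] <-].
    exists (gamma q * gamma q')%g; last by rewrite !mulgA mulgK.
    by exists (q * q')%g; [exact: (subgroupM sub2)|rewrite gammaM].
  + move=> _ [_ [q Gq <-] <-]; exists (gamma q)^-1%g; last by rewrite !invgM invgK mulgA.
    by exists q^-1%g; [exact: (subgroupV sub2)|rewrite gammaV].
- apply/sym_closedP => u ucl.
  suff [q Gq qE] : (gamma @` Gamma2) (h * u * h^-1)%g.
    exists (gamma q); first by exists q.
    by rewrite qE !mulgA mulVg mul1g mulgKV.
  apply: (proj1 (sym_closedP _) gamma_range_closed) => A fA.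
  have [_ [t Tt <-] tu] := ucl _ (finite_image h fA).
  exists t => // a Aa; have := tu (h a); rewrite !symM symVK => <-; last by exists a.
  by rewrite symVK.
apply/seteqP; split=> [g [s Ts sg]|_ [g _ <-]].
  have [g' [phi S]] := co_lift co (subT _ Ts); exists g' => //.
  apply/symP => w /=; have := sg (b w 0).
  by rewrite (acts_as_pi co _ S) !(co_pi co).
have [gh [phih H]] := co_lift co Gh.
have [q [phi [Gq Q]]] := co_ex co2 (gh * g * gh^-1)%g.
exists (h^-1 * gamma q * h)%g; first by exists (gamma q) => //; exists q.
move=> c; rewrite (acts_as_pi co _ (acts_asM (acts_asM (acts_asV H) (gammaP Q)) H)).
by rewrite !mulgA mulVg mul1g mulgKV.
Qed.

(** Sigma contains the whole image of asum in the kernel, which is the kernel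
    of the conjugate. *)
Lemma conj_range_minimal h Sigma : Gamma h -> is_full pi (@symG Omega l) Gamma Sigma ->
  Sigma `<=` conj_range h -> Sigma = conj_range h.
Proof.
move=> Gh full ST; apply/seteqP; split=> // x [_ [p Gp <-] xE].
have [gh [phih H]] := co_lift co Gh; have [gp [phip P]] := co_lift co2 Gp.
have [s [phis [Ss S]]] := full_ex Omega_infinite l_gt0 co full (gh^-1 * gp * gh)%g.
have [_ [q Gq <-] sE] := ST s Ss; have [gq [phiq Q]] := co_lift co2 Gq.
have gpq : gq = gp.
  have := acts_asM (acts_asM (acts_asV H) (gammaP Q)) H; rewrite sE => S'.
  by have [/mulIg/mulgI] := acts_as_uniq Omega_infinite l_gt0 co S' S.
subst gq.
have -> : x = ((h^-1 * (gamma p * (gamma q)^-1) * h) * s)%g.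
  by rewrite -xE -sE !mulgA mulgK mulgKV.
apply: (subgroupM (full_subgroup full)) => //.
pose e v := half4 (phip v - phiq v).
have de v : dbl (e v) = phip v - phiq v.
  by rewrite dbl_half // raddfB /= (co_par co2 Gp P) (co_par co2 Gq Q) subrr.
have E : acts_as b (gamma p * (gamma q)^-1)%g 1%g (fun w => dbl (asum e w)).
  have := acts_asM (gammaP P) (acts_asV (gammaP Q)); rewrite mulgV.
  apply: acts_as_ext => w; rewrite kset_imVK dbl_asum -asumB.
  by apply: asum_eq => v _; rewrite de.
apply: kernel_module_mem (acts_as_conj H E) => //.
  exact: co.
apply: (moduleG (kernel_module_closed Omega_infinite l_gt0 co full)).
exact: (alpha_kernel_module Omega_infinite l_gt0 co sub full).
Qed.

(** Lifts theta g of psi2 g to Z_4 make (g, asum (theta g)) a section of the range of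
    gamma modulo the kernel M of Sigma.  Comparing it with lifts sp g in Sigma gives a
    1-cocycle f modulo M; a function kap with coboundary f modulo M provides the
    conjugating element.  As Sigma is closed, it suffices to reach each element of
    the conjugate on finitely many fibres, and for this the permutation g may be
    replaced by a finitary g' that agrees with g on a finite set. *)
Lemma full_contains_conj Sigma : is_full pi (@symG Omega l) Gamma Sigma ->
  exists2 h, Gamma h & conj_range h `<=` Sigma.
Proof.
move=> full; have Mmod := kernel_module_closed Omega_infinite l_gt0 co full.
set M := kernel_module b Sigma in Mmod.
have alphaM f : M (asum f) := alpha_kernel_module Omega_infinite l_gt0 co sub full f.
have /choice[sp spP] g : exists sp : SymGroup C * (kset Omega l -> 'Z_4),
    Sigma sp.1 /\ acts_as b sp.1 g sp.2.
  have [s [phi SS]] := full_ex Omega_infinite l_gt0 co full g; by exists (s, phi).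
pose theta g v := lift01 (psi2 g v).
have par_f g w : par ((sp g).2 w - asum (theta g) w) = 0.
  have [Ss S] := spP g; rewrite raddfB /= (co_par co (full_sub full Ss) S) par_asum.
  by apply/eqP; rewrite subr_eq0; apply/eqP; apply: asum_eq => v _; rewrite par_lift01.
pose f g w := half4 ((sp g).2 w - asum (theta g) w).
have df g w : dbl (f g w) = (sp g).2 w - asum (theta g) w by apply: dbl_half.
have fM g h : M (fun w => f g w + f h (kset_im g w) + f (g * h)%g w).
  have [Sg Ag] := spP g; have [Sh Ah] := spP h; have [Sgh Agh] := spP (g * h)%g.
  pose e v := half4 (theta g v + theta h (kset_im g v) - theta (g * h)%g v).
  have de v : dbl (e v) = theta g v + theta h (kset_im g v) - theta (g * h)%g v.
    by apply: dbl_half; rewrite raddfB raddfD /= !par_lift01 (psi_mul co2 sub2) subrr.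
  pose m w := f g w + f h (kset_im g w) + f (g * h)%g w + asum e w.
  suff Mm : M m.
    apply: kernel_module_ext (moduleD Mmod Mm (alphaM e)) => w.
    by rewrite /m -addrA Z2_addxx addr0.
  exists ((sp g).1 * (sp h).1 * (sp (g * h)%g).1^-1)%g.
    by do ?apply: (subgroupM (full_subgroup full)) => //; apply: (subgroupV (full_subgroup full)).
  have := acts_asM (acts_asM Ag Ah) (acts_asV Agh); rewrite mulgV.
  apply: acts_as_ext => w; rewrite kset_imVK /m !raddfD /= -[dbl (f (g * h)%g w)]dbl_opp.
  have -> : dbl (asum e w) =
      asum (theta g) w + asum (theta h) (kset_im g w) - asum (theta (g * h)%g) w.
    by rewrite dbl_asum asum_im -asumD -asumB; apply: asum_eq => v _; apply: de.
  by rewrite !df cocycle_defect.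
have even n : ann M n -> forall x y, x != y ->
    ~~ odd (count (fun w => (x \in val w) && (y \in val w)) n).
  by move=> Nn x y xy; apply: (kernel_module_even Omega_infinite l_gt0 co sub full).
have [kap kapP] := cocycle_trivial Mmod Omega_infinite even fM.
have [k0 K0] := acts_as_ex co 1%g (fun w => dbl (kap w)).
have Gk0 : Gamma k0.
  apply: (co_mem co K0) => w; rewrite par_dbl /asum big1 // => v _.
  exact: (psi1 co2 sub2).
exists k0 => // _ [_ [p Gp <-] <-]; have [g [phi P]] := co_lift co2 Gp.
have Y := acts_asM (acts_asM (acts_asV K0) (gammaP P)) K0.
apply: (proj1 (sym_closedP _) (full_closed full)) => A fA.
have [Z AZ] := finite_shadow pi fA.
have uZ : uniq (map g (enum_fset Z)) by rewrite map_inj_uniq ?fset_uniq //; apply: sym_inj.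
have [g' fg' gg'] := finitary_map (fset_uniq Z) uZ (esym (size_map g _)).
have {}gg' x : x \in Z -> g' x = g x by move=> xZ; have /eq_in_map := gg'; apply.
have [Ss S] := spP g'.
pose e v := half4 (phi v - theta g' v).
have de v : (val v `<=` Z)%fset -> dbl (e v) = phi v - theta g' v.
  move=> /fsubsetP vZ; rewrite dbl_half // raddfB /= (co_par co2 Gp P) par_lift01.
  by rewrite (psi_agree co2 sub2 (g' := g')) ?subrr // => x /vZ /gg'.
have [u Su U] := moduleD Mmod (kapP g' fg') (alphaM e).
exists (u * (sp g').1)%g; first exact: (subgroupM (full_subgroup full)).
move=> c Ac; have [x <-] := co_surj co c; have /fsubsetP cZ := AZ c Ac.
rewrite (acts_asM U S) Y; move: (pi c) cZ => w wZ.
have -> : (1^-1 * g * 1)%g = g by rewrite invg1 mul1g mulg1.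
have -> : (1 * g')%g = g' by rewrite mul1g.
have gw : kset_im g' w = kset_im g w by apply: kset_im_eq => y /wZ /gg'.
rewrite gw; congr (b _ (_ + _)).
rewrite invg1 mul1g !kset_im1 dbl_opp !raddfD /=.
have -> : dbl (asum e w) = asum phi w - asum (theta g') w.
  rewrite dbl_asum -asumB; apply: asum_eq => v vw; apply: de.
  by apply: fsubset_trans vw _; apply/fsubsetP.
have -> : (sp g').2 w = dbl (f g' w) + asum (theta g') w by rewrite df subrK.
by apply: coboundary_defect; rewrite -raddfD Z2_addxx raddf0.
Qed.

End Gamma.

Local Close Scope ring_scope.

Theorem theorem1p2 (Omega : choiceType) (Omega_infinite : infinite_set [set: Omega])
    (C : nat -> Type) (Gamma : forall k, set (SymGroup (C k)))
    (pi : forall k, C k -> kset Omega k)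
    (free : forall k, (2 <= k)%N -> is_sign_cover (pi k) (Gamma k)) :
  (forall Sigma : set (SymGroup (C 2)),
     is_full (pi 2) (@symG Omega 2) (Gamma 2) Sigma -> Sigma = Gamma 2)
  /\
  (forall l, (2 <= l)%N ->
     exists gamma : SymGroup (C 2) -> SymGroup (C l),
     [/\ (forall g, Gamma 2 g -> Gamma l (gamma g)),
         (forall g h, Gamma 2 g -> Gamma 2 h ->
            gamma (g * h)%g = (gamma g * gamma h)%g),
         {within Gamma 2, continuous gamma},
         (forall f h, kernel_elt (pi 2) (Gamma 2) f h ->
            kernel_elt (pi l) (Gamma l) (alpha f) (gamma h))
       & (forall Sigma : set (SymGroup (C l)),
            is_minimally_full (pi l) (@symG Omega l) (Gamma l) Sigma <->
            exists2 h, Gamma l h & Sigma = image_conj (gamma @` Gamma 2) h)]).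
Proof.
have sub k (k2 : (2 <= k)%N) : is_subgroup (Gamma k).
  exact: (perm_structure_subgroup (cover_perm_structure (free_cover_finite (free k k2)))).
have cl k (k2 : (2 <= k)%N) : closed (Gamma k).
  exact: (perm_structure_closed (cover_perm_structure (free_cover_finite (free k k2)))).
have leq22 := leqnn 2.
have [b2 [psi2 co2]] := coords_exist Omega_infinite (free 2 leq22).
have psi2M := psi_mul co2 (sub 2 leq22).
split=> [Sigma full|l l2].
  apply/seteqP; split=> [s Ss|h Gh]; first exact: (full_sub full).
  have [g [phi H]] := co_lift co2 Gh.
  have [s [phi' [Ss S]]] := full_ex Omega_infinite (ltn0Sn 1) co2 full g.
  have -> : h = (h * s^-1 * s)%g by rewrite mulgKV.
  apply: (subgroupM (full_subgroup full)) => //.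
  pose e v := half4 (phi v - phi' v)%R.
  apply: (kernel_module_mem co2
    (alpha_kernel_module Omega_infinite (ltn0Sn 1) co2 (sub 2 leq22) full e)).
  have := acts_asM H (acts_asV S); rewrite mulgV; apply: acts_as_ext => v.
  rewrite kset_imVK asum_pair dbl_half // raddfB /= (co_par co2 Gh H).
  by rewrite (co_par co2 (full_sub full Ss) S) subrr.
have l0 : (0 < l)%N := ltnW l2.
have [b0 [psi co0]] := coords_exist Omega_infinite (free l l2).
have [|||t tE] := cohomologous (psi := psi) (psi' := fun g w => asum (psi2 g) w).
- exact: (psi_mul co0 (sub l l2)).
- by move=> g h w; rewrite asum_im -asumD; apply: asum_eq => v _; apply: psi2M.
- move=> g w gw; rewrite (co_sign co0 gw); symmetry.
  exact: (sign_sum psi2M (co_sign co2)).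
have co := coords_rebase co0 tE; set b := fun w x => _ in co.
have [gamma gammaP] := gamma_exists Omega_infinite co2 co.
exists gamma; split.
- exact: (gamma_mem co2 co gammaP).
- exact: (gammaM co2 co gammaP).
- exact: (gamma_continuous Omega_infinite co2 co gammaP).
- exact: (gamma_kernel co2 co gammaP).
have cfull := conj_range_full Omega_infinite l0 co2 (sub 2 leq22) co (sub l l2) (cl l l2) gammaP.
have cmin := conj_range_minimal Omega_infinite l0 co2 co (sub l l2) gammaP.
move=> Sigma; split=> [[full min]|[h Gh ->]].
  have [h Gh ST] := full_contains_conj Omega_infinite l0 co2 (sub 2 leq22) co (sub l l2) gammaP full.
  by exists h => //; rewrite (min _ (cfull h Gh) ST).
by split; [exact: cfull|move=> S fS ST; apply: cmin].
Qed.
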